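(* Suppose that $W$ is induced by a distribution $\widetilde W$ on $\theta\in\mathbb{R}^{k_n}$ admitting a density $w(\theta)$ with respect to Lebesgue measure. Suppose there exists a sequence $(M_n)_{n\ge1}$ of positive numbers such that, as $n\to\infty$: (1) $\displaystyle \sup_{\|\Phi h\|^2\le\sigma_n^2M_n,\ \|\Phi g\|^2\le\sigma_n^2M_n}\frac{w(\theta_0+h)}{w(\theta_0+g)}\to1$ (supremum over $h,g\in\mathbb{R}^{k_n}$); (2) $k_n\ln k_n=o(M_n)$; (3) $\displaystyle \max\left(0,\ \ln\left(\frac{\sqrt{\det(\Phi^T\Phi)}}{\sigma_n^{k_n}\,w(\theta_0)}\right)\right)=o(M_n)$. Then $$E\left\| W(dF\mid Y)-\mathcal{N}\left(Y_{\langle\phi\rangle},\sigma_n^2\Sigma\right)\right\|_{\mathrm{TV}}\longrightarrow 0\qquad\text{as } n\to\infty .$$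
   Context: For every $n\ge1$ one observes $Y=F+\varepsilon\in\mathbb{R}^n$ with $\varepsilon\sim\mathcal{N}(0,\sigma_n^2 I_n)$, where $\sigma_n>0$ is known and may depend on $n$. The true mean vector of $Y$ is $F_0\in\mathbb{R}^n$ (depending on $n$, otherwise arbitrary); $E$ denotes expectation when $Y\sim\mathcal{N}(F_0,\sigma_n^2I_n)$. Let $\Phi$ be an $n\times k_n$ real matrix of rank $k_n$ with columns the regressors $\phi_1,\dots,\phi_{k_n}$, where $1\le k_n\le n$ and $k_n$ grows with $n$ (in particular $k_n\ge2$ for all large $n$); $\langle\phi\rangle=\{\Phi\theta:\theta\in\mathbb{R}^{k_n}\}$; it is not assumed that $F_0\in\langle\phi\rangle$. Set $\Sigma=\Phi(\Phi^T\Phi)^{-1}\Phi^T$, $Y_{\langle\phi\rangle}=\Sigma Y$, $\theta_0=(\Phi^T\Phi)^{-1}\Phi^TF_0$. A prior $\widetilde W$ on $\theta\in\mathbb{R}^{k_n}$ induces the prior $W$ on $F=\Phi\theta$. $W(dF\mid Y)$ is the posterior distribution of $F$ given $Y$ when $F\sim W$ and, conditionally on $F$, $Y\sim\mathcal{N}(F,\sigma_n^2I_n)$. Everything (including $w$, $W$, $\Phi$) depends on $n$. Gaussian distributions with singular covariance are allowed; $\|\cdot\|$ is the Euclidean norm and $\|Q-Q'\|_{\mathrm{TV}}=\sup_A|Q(A)-Q'(A)|$. *)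

(* Defs.v *)
From HB Require Import structures.
From mathcomp Require Import all_boot all_order all_algebra.
From mathcomp Require Import all_classical all_reals all_analysis.
From mathcomp Require Import measurable_realfun.

Set Implicit Arguments.
Unset Strict Implicit.
Unset Printing Implicit Defensive.
Import Order.TTheory GRing.Theory Num.Theory.
Import numFieldNormedType.Exports.
Local Open Scope classical_set_scope.
Local Open Scope ring_scope.

(* The library norm [`|v|] of a matrix is the sup norm. *)
Definition enorm {R : realType} {n : nat} (v : 'cV[R]_n) : R :=
  Num.sqrt (\sum_(i < n) v i 0 ^+ 2).

(* Column vectors carry the product of the Borel sigma-algebras, i.e. the
   sigma-algebra generated by the coordinates, as for tuples in the library. *)
Section measurable_cV.
Context {R : realType} {n : nat}.

Definition cV_measurable : set (set 'cV[R]_n) :=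
  g_sigma_preimage (fun (i : 'I_n) (v : 'cV[R]_n) => v i 0 : measurableTypeR R).

Let cV_measurable0 : cV_measurable set0.
Proof. exact: sigma_algebra0. Qed.

Let cV_measurableC A : cV_measurable A -> cV_measurable (~` A).
Proof. exact: sigma_algebraC. Qed.

Let cV_measurable_bigcup (F : (set 'cV[R]_n)^nat) :
  (forall i, cV_measurable (F i)) -> cV_measurable (\bigcup_i F i).
Proof. exact: sigma_algebra_bigcup. Qed.

HB.instance Definition _ := @isMeasurable.Build default_measure_display
  'cV[R]_n cV_measurable cV_measurable0 cV_measurableC cV_measurable_bigcup.

End measurable_cV.

Section measurable_fun_cV.
Context {R : realType}.

Lemma measurable_coord n (i : 'I_n) :
  measurable_fun [set: 'cV[R]_n] (fun v => v i 0 : measurableTypeR R).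
Proof.
move=> _ Y mY; rewrite setTI; apply: sub_sigma_algebra => /=.
rewrite -bigcup_seq/=; exists i => /=; first by rewrite mem_index_enum.
by exists Y => //; rewrite setTI.
Qed.

Lemma measurable_fun_cVP d (T : measurableType d) n (f : T -> 'cV[R]_n) :
  (forall i, measurable_fun [set: T] (fun x => f x i 0 : measurableTypeR R)) ->
  measurable_fun [set: T] f.
Proof.
move=> mf _ A mA; rewrite setTI; move: A mA.
apply: smallest_sub => /=.
  split; first by rewrite /= preimage_set0.
    by move=> A; rewrite /= setTD preimage_setC; exact: measurableC.
  by move=> F mF; rewrite /= preimage_bigcup; exact: bigcup_measurable.
move=> A; rewrite -bigcup_seq => -[i _ [B mB <-]] /=.
by rewrite setTI -[X in measurable X]setTI; exact: mf.
Qed.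

Definition affine_map n p (m : 'cV[R]_n) (A : 'M[R]_(n, p)) (z : 'cV[R]_p) :
  'cV[R]_n := m + A *m z.

Lemma measurable_affine_map n p (m : 'cV[R]_n) (A : 'M[R]_(n, p)) :
  measurable_fun setT (affine_map m A).
Proof.
apply: measurable_fun_cVP => i.
under eq_fun do rewrite mxE mxE.
apply: (@measurable_funD _ _ R setT); first exact: measurable_cst.
apply: (@measurable_sum _ _ R) => j.
by apply: (@measurable_funM _ _ R); [exact: measurable_cst|exact: measurable_coord].
Qed.

Definition cons_cV n (p : measurableTypeR R * 'cV[R]_n) : 'cV[R]_n.+1 :=
  col_mx (p.1)%:M p.2.

Definition uncons_cV n (v : 'cV[R]_n.+1) : measurableTypeR R * 'cV[R]_n :=
  (v ord0 0, \col_i v (lift ord0 i) 0).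

Lemma cons_cV0 n (p : measurableTypeR R * 'cV[R]_n) :
  cons_cV p ord0 0 = p.1.
Proof.
have <- : lshift n (ord0 : 'I_1) = ord0 :> 'I_(1 + n) by exact/val_inj.
by rewrite /cons_cV (@col_mxEu _ 1 n 1 (p.1)%:M) mxE mulr1n.
Qed.

Lemma cons_cVS n (p : measurableTypeR R * 'cV[R]_n) i :
  cons_cV p (lift ord0 i) 0 = p.2 i 0.
Proof.
have <- : rshift 1 i = lift ord0 i :> 'I_(1 + n) by exact/val_inj.
by rewrite /cons_cV (@col_mxEd _ 1 n 1 (p.1)%:M).
Qed.

Lemma cons_cVK n : cancel (@cons_cV n) (@uncons_cV n).
Proof.
move=> [x v]; rewrite /uncons_cV cons_cV0; congr pair.
by apply/colP => i; rewrite mxE cons_cVS.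
Qed.

Lemma measurable_cons_cV n : measurable_fun setT (@cons_cV n).
Proof.
apply: measurable_fun_cVP => i.
have [<-|/unlift_some[j -> _]] := eqVneq ord0 i.
  by under eq_fun do rewrite cons_cV0; exact: measurable_fst.
under eq_fun do rewrite cons_cVS.
exact: measurableT_comp (measurable_coord j) measurable_snd.
Qed.

Lemma measurable_uncons_cV n : measurable_fun setT (@uncons_cV n).
Proof.
apply/measurable_fun_pairP; split; first exact: measurable_coord.
apply: measurable_fun_cVP => i; rewrite /=.
under eq_fun do rewrite mxE.
exact: measurable_coord.
Qed.

End measurable_fun_cV.

Section cons_measure.
Context {R : realType} {n : nat}.
Variables (m : {sigma_finite_measure set (measurableTypeR R) -> \bar R})
          (P : {sigma_finite_measure set 'cV[R]_n -> \bar R}).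
Local Open Scope ereal_scope.

Definition cons_measure : set 'cV[R]_n.+1 -> \bar R :=
  pushforward (m \x P) (@cons_cV R n).

Let cons_measure0 : cons_measure set0 = 0.
Proof. by rewrite /cons_measure /pushforward preimage_set0 measure0. Qed.

Let cons_measure_ge0 A : 0 <= cons_measure A.
Proof. by rewrite /cons_measure /pushforward measure_ge0. Qed.

Let cons_measure_sigma_additive : semi_sigma_additive cons_measure.
Proof.
move=> F mF tF mUF; rewrite /cons_measure /pushforward preimage_bigcup.
have mpre A : measurable A -> measurable (@cons_cV R n @^-1` A).
  by move=> mA; rewrite -[X in measurable X]setTI; exact: measurable_cons_cV.
apply: measure_semi_sigma_additive => [i||]; first exact: mpre.
- apply/trivIsetP => i j _ _ ij; rewrite -preimage_setI.
  by move/trivIsetP : tF => -> //; rewrite preimage_set0.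
- by rewrite -preimage_bigcup; exact: mpre.
Qed.

HB.instance Definition _ := isMeasure.Build _ _ _ cons_measure
  cons_measure0 cons_measure_ge0 cons_measure_sigma_additive.

Let cons_measure_sigma_finite : sigma_finite setT cons_measure.
Proof.
have /sigma_finiteP[F [TF ndF Foo]] := sigma_finiteT m.
have /sigma_finiteP[G [TG ndG Goo]] := sigma_finiteT P.
exists (fun i => @uncons_cV R n @^-1` (F i `*` G i)).
  rewrite -preimage_bigcup (_ : \bigcup_i _ = setT) ?preimage_setT//.
  apply/seteqP; split=> // -[x y] _.
  have [i _ Fix] : (\bigcup_i F i) x by rewrite -TF.
  have [j _ Gjy] : (\bigcup_i G i) y by rewrite -TG.
  exists (maxn i j) => //; split=> /=.
    by move: x Fix; exact/subsetPset/ndF/leq_maxl.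
  by move: y Gjy; exact/subsetPset/ndG/leq_maxr.
move=> i; have [mFi Fioo] := Foo i; have [mGi Gioo] := Goo i; split.
  rewrite -[X in measurable X]setTI.
  by apply: measurable_uncons_cV => //; exact: measurableX.
rewrite /cons_measure /pushforward -comp_preimage.
rewrite (_ : _ \o _ = id); last by apply/funext => p /=; rewrite cons_cVK.
by rewrite preimage_id product_measure1E// lte_mul_pinfty// ge0_fin_numE.
Qed.

HB.instance Definition _ := Measure_isSigmaFinite.Build _ _ _
  cons_measure cons_measure_sigma_finite.

End cons_measure.

(* The n-fold product of a measure on the line, as a measure on R^n. *)
Fixpoint power_measure {R : realType}
    (m : {sigma_finite_measure set (measurableTypeR R) -> \bar R}) (n : nat) :
    {sigma_finite_measure set 'cV[R]_n -> \bar R} :=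
  match n with
  | 0 => \d_(0 : 'cV[R]_0)
  | n'.+1 => cons_measure m (power_measure m n')
  end.

Section power_measure_theory.
Context {R : realType}.
Variable m : {sigma_finite_measure set (measurableTypeR R) -> \bar R}.

Lemma power_measureT n : m setT = 1%E -> power_measure m n setT = 1%E.
Proof.
move=> m1; elim: n => [|n IHn] /=; first by rewrite diracT.
have E : (m setT * power_measure m n setT = 1)%E by rewrite m1 IHn mule1.
rewrite /cons_measure /pushforward preimage_setT -setXTT.
exact: etrans (product_measure1E _ _ measurableT measurableT) E.
Qed.

End power_measure_theory.

Definition lebesgue_cV {R : realType} (n : nat) :
    {sigma_finite_measure set 'cV[R]_n -> \bar R} :=
  power_measure lebesgue_measure n.

Section std_normal.
Context {R : realType} {n : nat}.

Definition std_normal : set 'cV[R]_n -> \bar R :=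
  power_measure (normal_prob (0 : R) 1) n.

HB.instance Definition _ := Measure.on std_normal.

Let std_normalT : std_normal setT = 1%E.
Proof. by apply: power_measureT; exact: probability_setT. Qed.

HB.instance Definition _ :=
  Measure_isProbability.Build _ _ R std_normal std_normalT.

End std_normal.

HB.instance Definition _ (R : realType) n p (m : 'cV[R]_n) (A : 'M[R]_(n, p)) :=
  isMeasurableFun.Build _ _ _ _ (affine_map m A) (measurable_affine_map m A).

Lemma measurable_mulmx {R : realType} n p (A : 'M[R]_(n, p)) :
  measurable_fun setT (mulmx A : 'cV[R]_p -> 'cV[R]_n).
Proof.
rewrite (_ : mulmx A = affine_map 0 A); first exact: measurable_affine_map.
by apply/funext => z; rewrite /affine_map add0r.
Qed.

HB.instance Definition _ (R : realType) n p (A : 'M[R]_(n, p)) :=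
  isMeasurableFun.Build _ _ _ _ (mulmx A : 'cV[R]_p -> 'cV[R]_n)
    (measurable_mulmx A).

(* N(m, S) for a possibly singular covariance S: the law of [m + A Z] with [Z]
   standard normal and [A *m A^T = S]; it does not depend on the choice of [A].
   Meaningful for S symmetric positive semidefinite, where such an A exists. *)
Definition mvnormal {R : realType} {n : nat} (m : 'cV[R]_n) (S : 'M[R]_n) :
    probability 'cV[R]_n R :=
  distribution std_normal (affine_map m (xget 0 [set A : 'M[R]_n | A *m A^T = S])).

Definition has_density {R : realType} {n : nat} (P : set 'cV[R]_n -> \bar R)
    (w : 'cV[R]_n -> R) : Prop :=
  [/\ measurable_fun setT w, forall x, 0 <= w x &
      forall A, measurable A -> P A = (\int[lebesgue_cV n]_(x in A) (w x)%:E)%E].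

(* [K] is a version of the conditional distribution of F given Y when F has law
   [W] and Y given F is N(F, s^2 I): the two sides are P(F \in A, Y \in B) and
   E[K(Y, A); Y \in B]. *)
Definition is_posterior {R : realType} {n : nat} (W : set 'cV[R]_n -> \bar R)
    (s : R) (K : R.-pker 'cV[R]_n ~> 'cV[R]_n) : Prop :=
  forall A B, measurable A -> measurable B ->
    (\int[W]_(f in A) mvnormal f (s ^+ 2)%:M B =
     \int[W]_f \int[mvnormal f (s ^+ 2)%:M]_(y in B) K y A)%E.

Definition tv_dist d (T : measurableType d) (R : realType)
    (P Q : set T -> \bar R) : \bar R :=
  ereal_sup [set `|P A - Q A|%E | A in measurable].

Definition hat_mx {R : realType} {n p : nat} (Phi : 'M[R]_(n, p)) : 'M[R]_n :=
  Phi *m invmx (Phi^T *m Phi) *m Phi^T.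

Definition ls_coef {R : realType} {n p : nat} (Phi : 'M[R]_(n, p))
    (F : 'cV[R]_n) : 'cV[R]_p :=
  invmx (Phi^T *m Phi) *m Phi^T *m F.

(* Supremum of w(t0 + h) / w(t0 + g) over |Phi h|^2, |Phi g|^2 <= r, taken in
   the extended reals, where [x / 0 = +oo] for [x > 0] (and [0 / 0 = 0]): it is
   infinite as soon as w vanishes at some but not all points of the set. *)
Definition sup_ratio {R : realType} {n p : nat} (Phi : 'M[R]_(n, p))
    (w : 'cV[R]_p -> R) (t0 : 'cV[R]_p) (r : R) : \bar R :=
  ereal_sup [set ((w (t0 + hg.1))%:E / (w (t0 + hg.2))%:E)%E | hg in
    [set hg : 'cV[R]_p * 'cV[R]_p |
      enorm (Phi *m hg.1) ^+ 2 <= r /\ enorm (Phi *m hg.2) ^+ 2 <= r]].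

(* Main.v *)
(* Write Phi = U T with U^T U = 1 and T invertible (Cholesky factorisation of
   Phi^T Phi).  In the coordinate theta, the target N(Sigma y, s^2 Sigma) has the
   density q_y(theta) = |det T| s^-k g((T theta - U^T y) / s), with g the standard
   normal density, and by Bayes' formula the posterior is proportional to w q_y
   for almost every y.  Let B be the set where |T (theta - theta0)|^2 <= s^2 M.
   If |U^T (y - F0)|^2 <= s^2 M / 4, then |T theta - U^T y|^2 > s^2 M / 4 off B, so
   there q_y <= |det T| s^-k exp (- M / 8), which is o(w(theta0)) by (3), and B^c
   has q_y-mass at most P(|Z|^2 > M / 4) for Z standard normal in R^k; by (1), w is
   nearly constant on B, so both distributions are close.  The excluded y have
   probability P(|Z|^2 > M / 4) as well, which is at most 2^(k/2) exp (- M / 16)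
   since E exp (|Z|^2 / 4) = 2^(k/2), and tends to 0 by (2). *)
Require Import Defs.
From HB Require Import structures.
From mathcomp Require Import all_boot all_order all_algebra.
From mathcomp Require Import all_classical all_reals all_analysis.
From mathcomp Require Import measurable_realfun ring lra.

Set Implicit Arguments.
Unset Strict Implicit.
Unset Printing Implicit Defensive.
Import Order.TTheory GRing.Theory Num.Theory.
Import numFieldNormedType.Exports.
Local Open Scope classical_set_scope.
Local Open Scope ring_scope.

(** * Integration tools *)

(** The kernel [post] is pinned down only by an identity over rectangles, hence only up to a null
    set of [y] that a priori depends on the event. A single null set is obtained from countably many
    boxes; it is negligible for the true law of [y], which has a Lebesgue density wherever [F0]
    lies. For k < n the target has no density on R^n. This is why everything is transported to
    [theta], and why the law of [A Z] must first be shown to depend on [A *m A^T] only. The two laws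
    are compared through unnormalised masses: if a <= w <= b on B, then w q_y lies between a q_y and
    b q_y there, and its total mass is at least a (1 - p), so that normalising costs a factor close
    to b / a. The 1/4 in the threshold comes from |u + v|^2 <= 2 |u|^2 + 2 |v|^2. Hypothesis (2)
    serves twice: it absorbs the factor 2^(k/2) of the tail bound and, because k >= 2 eventually, it
    forces M to tend to infinity. *)

Definition image_measure d d' (T : measurableType d) (T' : measurableType d')
    (R : realType) (mu : {measure set T -> \bar R}) (phi : T -> T')
    (mphi : measurable_fun setT phi) : {measure set T' -> \bar R} :=
  @measure_function_pushforward__canonical__measure_function_Measure
    _ _ _ _ _ mu phi mphi.

Section integral_tools.
Local Open Scope ereal_scope.
Context d (T : measurableType d) (R : realType).

Import HBNNSimple.

(* The integrand of [theorem2] is a supremum over uncountably many sets, which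
   need not be measurable. *)
Lemma ge0_le_integral_nonmeasurable (mu : {measure set T -> \bar R})
    (f g : T -> \bar R) :
  (forall x, 0 <= f x) -> (forall x, f x <= g x) ->
  \int[mu]_x f x <= \int[mu]_x g x.
Proof.
move=> f0 fg; have g0 x : 0 <= g x by exact: le_trans (f0 x) (fg x).
rewrite !ge0_integralTE//; apply: le_ereal_sup => _ [h hf <-].
exists h => // x.
exact: le_trans (hf x) (fg x).
Qed.

(** The hypothesis is the case of indicators; linearity gives simple functions, and monotone
    convergence along [nnsfun_approx] gives [g]. *)
Lemma integral_density (mu nu : {measure set T -> \bar R}) (f : T -> R)
    (g : T -> \bar R) :
  measurable_fun setT f -> (forall x, (0 <= f x)%R) ->
  (forall A, measurable A -> nu A = \int[mu]_(x in A) (f x)%:E) ->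
  measurable_fun setT g -> (forall x, 0 <= g x) ->
  \int[nu]_x g x = \int[mu]_x (g x * (f x)%:E).
Proof.
move=> mf f0 nuE mg g0.
have mEf : measurable_fun setT (EFin \o f) by exact/measurable_EFinP.
pose h := nnsfun_approx measurableT mg.
have -> : \int[nu]_x g x = lim (\int[nu]_x (EFin \o h n) x @[n --> \oo]).
  rewrite -monotone_convergence//.
  - by apply: eq_integral => x _; apply/esym/cvg_lim => //; exact: cvg_nnsfun_approx.
  - by move=> n; exact/measurable_EFinP/measurable_funP.
  - by move=> n x _ /=; rewrite lee_fin.
  - by move=> x _ a b ab; rewrite lee_fin; exact/lefP/nd_nnsfun_approx.
have -> : \int[mu]_x (g x * (f x)%:E) =
    lim (\int[mu]_x ((EFin \o h n) x * (f x)%:E) @[n --> \oo]).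
  rewrite -monotone_convergence//.
  - apply: eq_integral => x _; apply/esym/cvg_lim => //; apply: cvgeZr => //.
    exact: cvg_nnsfun_approx.
  - by move=> n; apply/emeasurable_funM => //; exact/measurable_EFinP.
  - by move=> n x _ /=; rewrite mule_ge0 ?lee_fin ?f0.
  - move=> x _ a b ab; rewrite lee_wpmul2r ?lee_fin ?f0//.
    exact/lefP/nd_nnsfun_approx.
suff suf n : \int[mu]_x ((EFin \o h n) x * (f x)%:E) =
    \int[nu]_x (EFin \o h n) x by under eq_fun do rewrite -suf.
transitivity (\int[nu]_x
   (\sum_(y \in range (h n)) (y * \1_(h n @^-1` [set y]) x)%:E)); last first.
  by apply: eq_integral => t tE; rewrite /= fimfunE -fsumEFin.
have indich m r : measurable_fun setT (fun x => (r * \1_(h m @^-1` [set r]) x)%:E).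
  by apply: (measurable_comp measurableT) => //; exact: measurable_funM.
rewrite ge0_integral_fsum//; last by move=> m y Ey; exact: nnfun_muleindic_ge0.
transitivity (\int[mu]_x (\sum_(y \in range (h n))
    (y * \1_(h n @^-1` [set y]) x)%:E * (f x)%:E)).
  under [RHS]eq_integral => x xE.
    rewrite -ge0_mule_fsuml => [|y]; last exact: nnfun_muleindic_ge0.
    rewrite fsumEFin // -(fimfunE _ x); over.
  by [].
rewrite ge0_integral_fsum//; last 2 first.
  - by move=> y; apply: emeasurable_funM.
  - move=> m y Ey; apply: mule_ge0; last by rewrite lee_fin.
    exact: nnfun_muleindic_ge0.
apply: eq_fsbigr => r rhn.
under [RHS]eq_integral do rewrite EFinM.
rewrite integralZl_indic_nnsfun => //.
under eq_integral do rewrite EFinM -muleA.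
rewrite ge0_integralZl//.
- under eq_integral do rewrite muleC.
  rewrite (eq_integral ((EFin \o f) \_ (h n @^-1` [set r]))); last first.
    by move=> x xE; rewrite epatch_indic.
  by rewrite -integral_mkcondr setTI -nuE// integral_indic// setIT.
- by apply: emeasurable_funM => //; exact/measurable_EFinP.
- by move=> t Et; rewrite mule_ge0 ?lee_fin ?f0.
- by move: rhn; rewrite inE => -[t _ <-]; rewrite lee_fin.
Qed.

End integral_tools.

Section lebesgue_affine.
Context {R : realType}.
Local Open Scope ereal_scope.
Local Notation mu := (@lebesgue_measure R).
Variables (u b : R).
Hypothesis u0 : u != 0%R.

Let phi : measurableTypeR R -> measurableTypeR R := fun x => (u * x + b)%R.

Let mphi : measurable_fun setT phi.
Proof. by apply: (@measurable_funD _ _ R) => //; exact: (@measurable_funM _ _ R). Qed.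


Let absu_gt0 : (0 < `|u|)%R. Proof. by rewrite normr_gt0. Qed.

(** By uniqueness of Lebesgue measure it suffices that the image measure, scaled by |u|, gives
    half-open intervals their length. A negative [u] exchanges the open and the closed end, hence
    the two cases. *)
Lemma lebesgue_affine A : measurable A ->
  pushforward mu phi A = `|u|^-1%:E * mu A.
Proof.
move=> mA; pose r : {nonneg R} := NngNum (ltW absu_gt0).
suff -> : mu A = mscale r (image_measure mu mphi) A.
  by rewrite /mscale/= muleA -EFinM mulVf ?mul1e// gt_eqF.
pose nu := mscale r (image_measure mu mphi).
apply: (@lebesgue_measure_unique _ nu) => // _ [[x y]] _ <-.
rewrite -[RHS]/(`|u|%:E * mu (phi @^-1` `]x, y])).
have [u_gt0|] := ltP 0%R u; last rewrite le_eqVlt (negbTE u0)/= => u_lt0.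
  have -> : phi @^-1` `]x, y] = `]((x - b) / u)%R, ((y - b) / u)%R]%classic.
    apply/seteqP; split=> z /=; rewrite !in_itv/= /phi.
      by move=> /andP[h1 h2]; rewrite ltr_pdivrMr// ler_pdivlMr// ltrBlDr lerBrDr mulrC h1.
    by rewrite ltr_pdivrMr// ler_pdivlMr// ltrBlDr lerBrDr [(z * u)%R]mulrC.
  rewrite !lebesgue_measure_itv/= !lte_fin ltr_pM2r ?invr_gt0// ltrD2r.
  case: ifPn => xy; last by rewrite mule0.
  by rewrite gtr0_norm// -!EFinB -EFinM; congr EFin; field.
have -> : phi @^-1` `]x, y] = `[((y - b) / u)%R, ((x - b) / u)%R[%classic.
  apply/seteqP; split=> z /=; rewrite !in_itv/= /phi.
    by move=> /andP[h1 h2]; rewrite ltr_ndivlMr// ler_ndivrMr// ltrBlDr lerBrDr mulrC h1 h2.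
  by rewrite ltr_ndivlMr// ler_ndivrMr// ltrBlDr lerBrDr [(z * u)%R]mulrC andbC.
rewrite !lebesgue_measure_itv/= !lte_fin ltr_nM2r ?invr_lt0// ltrD2r.
case: ifPn => xy; last by rewrite mule0.
by rewrite ltr0_norm// -!EFinB -EFinM; congr EFin; field.
Qed.

Lemma integral_lebesgue_affine (f : measurableTypeR R -> \bar R) :
  measurable_fun setT f -> (forall x, 0 <= f x) ->
  \int[mu]_x f (u * x + b)%R = `|u|^-1%:E * \int[mu]_x f x.
Proof.
move=> mf f0.
have v0 : (0 <= `|u|^-1)%R by rewrite invr_ge0.
rewrite -[RHS](@ge0_integral_mscale _ _ _ mu setT measurableT (NngNum v0))//.
rewrite -[LHS]/(\int[mu]_(x in phi @^-1` setT) (f \o phi) x).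
rewrite -(ge0_integral_pushforward mphi)//.
by apply: eq_measure_integral => A mA _; exact: lebesgue_affine.
Qed.

End lebesgue_affine.

Section integral_cons.
Context {R : realType} {n : nat}.
Local Open Scope ereal_scope.
Variable m : {sigma_finite_measure set (measurableTypeR R) -> \bar R}.
Variable f : 'cV[R]_n.+1 -> \bar R.
Hypothesis mf : measurable_fun setT f.
Hypothesis f0 : forall x, 0 <= f x.

Let mfc : measurable_fun setT (f \o @cons_cV R n).
Proof. exact: measurableT_comp mf (@measurable_cons_cV R n). Qed.

Lemma integral_power_measureS :
  \int[power_measure m n.+1]_v f v =
  \int[m]_x \int[power_measure m n]_v f (cons_cV (x, v)).
Proof.
rewrite -(fubini_tonelli1 (f \o @cons_cV R n))//; last by move=> ?; exact: f0.
exact: (ge0_integral_pushforward (@measurable_cons_cV R n)).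
Qed.

(** Both orders of integration are needed: block upper triangular maps are handled with the first
    coordinate innermost, block lower triangular ones with the other coordinates innermost. *)
Lemma integral_power_measureS_swap :
  \int[power_measure m n.+1]_v f v =
  \int[power_measure m n]_v \int[m]_x f (cons_cV (x, v)).
Proof.
rewrite integral_power_measureS.
by apply: (fubini_tonelli (f \o @cons_cV R n)) => // ?; exact: f0.
Qed.

End integral_cons.

(** * Linear change of variables *)

Section cons_uncons.
Context {R : realType} {n : nat}.
Implicit Types (v c : 'cV[R]_n.+1).

Lemma uncons_cVK : cancel (@uncons_cV R n) (@cons_cV R n).
Proof.
move=> v; apply/colP => i; have [<-|/unlift_some[j -> _]] := eqVneq ord0 i.
  by rewrite cons_cV0.
by rewrite cons_cVS mxE.
Qed.

Lemma cons_cVD (p q : measurableTypeR R * 'cV[R]_n) :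
  cons_cV p + cons_cV q = cons_cV ((p.1 : R) + q.1, p.2 + q.2).
Proof. by rewrite /cons_cV (@add_col_mx _ 1 n) -raddfD. Qed.

Lemma mul_block_cons (a : 'M[R]_1) (r : 'rV[R]_n) (c : 'cV[R]_n) (D : 'M[R]_n)
    (x : measurableTypeR R) (v : 'cV[R]_n) :
  (block_mx a r c D : 'M[R]_n.+1) *m cons_cV (x, v) =
  cons_cV ((a 0 0 * x + (r *m v) 0 0 : measurableTypeR R), (x : R) *: c + D *m v).
Proof.
rewrite /cons_cV (@mul_block_col _ 1 n 1 n) /=.
congr (@col_mx _ 1 n 1 _ _); last by rewrite mul_mx_scalar.
apply/matrixP => i j; rewrite !ord1 mul_mx_scalar !mxE.
by rewrite mulr1n [x * _]mulrC.
Qed.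

End cons_uncons.

(** The first column of an invertible matrix is nonzero, so if its top entry vanishes, adding one
    suitable lower row to row 0 repairs it. *)
Lemma exists_pivot (R : realType) n (A : 'M[R]_n.+1) : A \in unitmx ->
  exists r : 'rV[R]_n,
    ((block_mx 1%:M r 0 1%:M : 'M[R]_n.+1) *m A) ord0 ord0 != 0.
Proof.
move=> uA; have [A00|A00] := eqVneq (A ord0 ord0) 0; last first.
  exists 0; rewrite (_ : block_mx _ _ _ _ = 1%:M) ?mul1mx//.
  by rewrite -(@scalar_mx_block _ 1 n).
have [i Ai0] : exists i : 'I_n, (A (lift ord0 i) ord0 != 0).
  apply/existsP; apply: contraT; rewrite negb_exists => /forallP A0.
  have : A *m delta_mx ord0 ord0 = 0 :> 'cV[R]_n.+1.
    rewrite -colE; apply/colP => i; rewrite !mxE.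
    have [<-//|/unlift_some[j -> _]] := eqVneq ord0 i.
    by have := A0 j; rewrite negbK => /eqP.
  move/(congr1 (mulmx (invmx A))); rewrite mulKmx// mulmx0 => /colP/(_ ord0).
  by rewrite !mxE eqxx => /eqP; rewrite oner_eq0.
have ur (r : 'rV[R]_n) j :
    (block_mx 1%:M r 0 1%:M : 'M[R]_n.+1) ord0 (lift ord0 j) = r 0 j.
  rewrite -(@block_mxEur _ 1 n 1 n 1%:M r 0 1%:M).
  by congr (block_mx _ _ _ _ _ _); exact/val_inj.
exists (delta_mx 0 i); rewrite mxE big_ord_recl A00 mulr0 add0r.
rewrite (bigD1 i)//= big1 ?addr0 => [|j ji].
  by rewrite ur mxE !eqxx mul1r.
by rewrite ur mxE (negbTE ji) andbF mul0r.
Qed.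

Section linear_change.
Context {R : realType}.
Local Open Scope ereal_scope.
Local Notation lam := (@lebesgue_cV R _).

Lemma measurable_cons_cV1 n (v : 'cV[R]_n) :
  measurable_fun setT (fun x : measurableTypeR R => cons_cV (x, v)).
Proof. exact: measurableT_comp (@measurable_cons_cV R n) (pair2_measurable v). Qed.

Lemma measurable_cons_cV2 n (x : measurableTypeR R) :
  measurable_fun setT (fun v : 'cV[R]_n => cons_cV (x, v)).
Proof. exact: measurableT_comp (@measurable_cons_cV R n) (pair1_measurable x). Qed.

Lemma measurable_integral_cons n
    (m : {sigma_finite_measure set (measurableTypeR R) -> \bar R})
    (f : 'cV[R]_n.+1 -> \bar R) :
  measurable_fun setT f -> (forall v, 0 <= f v) ->
  measurable_fun setT (fun v : 'cV[R]_n => \int[m]_x f (cons_cV (x, v))).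
Proof.
move=> mf f0.
apply: (measurable_fun_fubini_tonelli_G (m1 := m) (f \o @cons_cV R n)).
  exact: measurableT_comp mf (@measurable_cons_cV R n).
by move=> ?; exact: f0.
Qed.

Lemma lebesgue_cVS n : lebesgue_cV n.+1 = power_measure (@lebesgue_measure R) n.+1.
Proof. by []. Qed.

Lemma measurable_addc_cV n (c : 'cV[R]_n) : measurable_fun setT (+%R c).
Proof.
rewrite (_ : +%R c = affine_map c 1%:M); first exact: measurable_affine_map.
by apply/funext => v; rewrite /affine_map mul1mx.
Qed.

Lemma integral_lebesgue_translate n (c : 'cV[R]_n) (f : 'cV[R]_n -> \bar R) :
  measurable_fun setT f -> (forall v, 0 <= f v) ->
  \int[lam]_v f (c + v)%R = \int[lam]_v f v.
Proof.
elim: n c f => [|n IH] c f mf f0.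
  by apply: eq_integral => v _; rewrite [c]flatmx0 add0r.
have mfc : measurable_fun setT (fun v => f (c + v)%R).
  exact: measurableT_comp mf (measurable_addc_cV c).
have fc0 v : 0 <= f (c + v)%R by exact: f0.
rewrite !lebesgue_cVS (integral_power_measureS_swap _ mfc fc0).
rewrite (integral_power_measureS_swap _ mf f0).
have : c = cons_cV (uncons_cV c) by rewrite uncons_cVK.
case: (uncons_cV c) => c0 c1 -> .
pose G v := \int[lebesgue_measure]_x f (cons_cV (x, v)).
have mG : measurable_fun setT G by exact: measurable_integral_cons.
have G0 v : 0 <= G v by apply: integral_ge0 => x _; exact: f0.
rewrite -[RHS]/(\int[lam]_v G v) -(IH c1 G mG G0).
apply: eq_integral => v _.
transitivity (\int[lebesgue_measure]_x
    f (cons_cV ((1 * (x : R) + c0)%R : measurableTypeR R, (c1 + v)%R))).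
  by apply: eq_integral => x _; rewrite cons_cVD/= addrC mul1r.
rewrite (@integral_lebesgue_affine R 1%R c0 _ (fun x => f (cons_cV (x, c1 + v)%R)))//.
  by rewrite normr1 invr1 mul1e.
exact: measurableT_comp mf (measurable_cons_cV1 _).
Qed.

Let lebesgue_linear n (A : 'M[R]_n) := forall f : 'cV[R]_n -> \bar R,
  measurable_fun setT f -> (forall v, 0 <= f v) ->
  \int[lam]_v f (A *m v) = `|\det A|^-1%:E * \int[lam]_v f v.

Let lebesgue_linearM n (A B : 'M[R]_n) :
  lebesgue_linear A -> lebesgue_linear B -> lebesgue_linear (A *m B).
Proof.
move=> hA hB f mf f0.
under eq_integral do rewrite -mulmxA.
rewrite (hB (fun v => f (A *m v)))//; last first.
  exact: measurableT_comp mf (measurable_mulmx A).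
by rewrite hA// muleA -EFinM det_mulmx normrM invfM mulrC.
Qed.

(** With the other coordinates fixed, the first one undergoes an affine map of slope [a 0 0]; what
    remains is the formula for [D]. *)
Let lebesgue_linear_ublock n (a : 'M[R]_1) (r : 'rV[R]_n) (D : 'M[R]_n) :
  (a 0 0 != 0)%R -> lebesgue_linear D ->
  lebesgue_linear (block_mx a r 0%R D : 'M[R]_n.+1).
Proof.
move=> a0 hD f mf f0; rewrite !lebesgue_cVS !integral_power_measureS_swap//; last first.
  exact: measurableT_comp mf (measurable_mulmx _).
pose G v := \int[lebesgue_measure]_x f (cons_cV (x, v)).
have mG : measurable_fun setT G by exact: measurable_integral_cons.
have G0 v : 0 <= G v by apply: integral_ge0 => x _; exact: f0.
rewrite -[X in _ * X]/(\int[lam]_v G v).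
transitivity (\int[lam]_v ((`|a 0 0|^-1)%R%:E * G (D *m v))).
  apply: eq_integral => v _.
  under eq_integral => x _ do rewrite mul_block_cons scaler0 add0r.
  rewrite (integral_lebesgue_affine _ a0 (f := fun x => f (cons_cV (x, D *m v))))//.
  exact: measurableT_comp mf (measurable_cons_cV1 _).
have mGD : measurable_fun setT (fun v => G (D *m v)).
  exact: measurableT_comp mG (measurable_mulmx D).
have GD0 v : setT v -> 0 <= G (D *m v) by move=> _; exact: G0.
have a0' : (0 <= `|a 0 0|^-1)%R by rewrite invr_ge0.
rewrite (ge0_integralZl_EFin _ measurableT GD0 mGD a0').
rewrite hD// muleA -EFinM; congr (_%:E * _).
by rewrite (@det_ublock _ 1 n) det_mx11 normrM invfM.
Qed.

Let lebesgue_linear1 n : lebesgue_linear (1%:M : 'M[R]_n).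
Proof.
move=> f mf f0; rewrite det1 normr1 invr1 mul1e.
by apply: eq_integral => v _; rewrite mul1mx.
Qed.

(** With the first coordinate fixed, the other ones are merely translated. *)
Let lebesgue_linear_lblock n (c : 'cV[R]_n) :
  lebesgue_linear (block_mx 1%:M 0%R c 1%:M : 'M[R]_n.+1).
Proof.
move=> f mf f0; rewrite !lebesgue_cVS !integral_power_measureS//; last first.
  exact: measurableT_comp mf (measurable_mulmx _).
rewrite (@det_lblock _ 1 n) !det1 mul1r normr1 invr1 mul1e.
apply: eq_integral => x _.
under eq_integral => v _ do rewrite mul_block_cons mxE mul1r mul0mx mxE addr0 mul1mx.
rewrite (@integral_lebesgue_translate _ _ (fun v => f (cons_cV (x, v))))//.
exact: measurableT_comp mf (measurable_cons_cV2 _).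
Qed.

(* Induction on [n]: after a transvection making the (0, 0) entry nonzero, [A] is
   a product of a block lower and a block upper triangular matrix, to which
   Fubini applies. *)
Lemma integral_lebesgue_linear n (A : 'M[R]_n) (f : 'cV[R]_n -> \bar R) :
  A \in unitmx -> measurable_fun setT f -> (forall v, 0 <= f v) ->
  \int[lam]_v f (A *m v) = `|\det A|^-1%:E * \int[lam]_v f v.
Proof.
move=> uA; move: f; rewrite -/(lebesgue_linear A).
elim: n A uA => [A _|n IH A uA].
  by rewrite (flatmx0 A) -(flatmx0 1%:M); exact: lebesgue_linear1.
have [r] := exists_pivot uA.
set T : 'M[R]_n.+1 := block_mx 1%:M r 0%R 1%:M; set B := T *m A => B00.
have -> : A = (block_mx 1%:M (- r) 0 1%:M : 'M[R]_n.+1) *m B.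
  rewrite mulmxA (@mulmx_block _ 1 n 1 n 1 n) !mulmx0 !mul0mx !mulmx1 !mul1mx.
  by rewrite !addr0 !add0r addrN -(@scalar_mx_block _ 1 n) mul1mx.
have uB : B \in unitmx.
  by rewrite unitmx_mul uA andbT unitmxE (@det_ublock _ 1 n) !det1 mulr1 unitr1.
apply: lebesgue_linearM.
  by apply: lebesgue_linear_ublock; [rewrite mxE oner_neq0|exact: lebesgue_linear1].
have : B = (block_mx (@ulsubmx _ 1 n 1 n B) (@ursubmx _ 1 n 1 n B)
                    (@dlsubmx _ 1 n 1 n B) (@drsubmx _ 1 n 1 n B)).
  by rewrite submxK.
set b := ulsubmx _; set r' := ursubmx _; set c := dlsubmx _; set D := drsubmx _ => BE.
have b00 : (b 0 0 != 0)%R.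
  rewrite (_ : b _ _ = B ord0 ord0)// /b mxE mxE.
  have E : lshift n (ord0 : 'I_1) = ord0 :> 'I_(1 + n) by exact/val_inj.
  by rewrite -[in RHS]E; congr (B _ _).
(* [D'] is the Schur complement of the pivot; it is invertible because \det B = b \det D'. *)
pose c' := ((b 0 0)^-1 *: c)%R; pose D' := (D - c' *m r')%R.
have BE' : B = (block_mx 1%:M 0 c' 1%:M : 'M[R]_n.+1) *m
               (block_mx b r' 0 D' : 'M[R]_n.+1).
  rewrite BE (@mulmx_block _ 1 n 1 n 1 n) !mulmx0 !mul0mx !mul1mx !addr0.
  congr (@block_mx _ 1 n 1 n _ _ _ _); last by rewrite /D' addrC subrK.
  by rewrite [b]mx11_scalar mul_mx_scalar /c' scalerA mulfV ?scale1r// mxE.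
rewrite BE'; apply: lebesgue_linearM; first exact: lebesgue_linear_lblock.
apply: lebesgue_linear_ublock => //; apply: IH.
move: uB; rewrite BE' unitmxE det_mulmx (@det_ublock _ 1 n).
by rewrite !unitrM unitmxE => /andP[_ /andP[]].
Qed.

End linear_change.

(** * The standard normal distribution *)

Section sqnorm.
Context {R : realType}.

Definition sqnorm n (v : 'cV[R]_n) : R := \sum_(i < n) v i 0 ^+ 2.

Lemma sqr_enorm n (v : 'cV[R]_n) : enorm v ^+ 2 = sqnorm v.
Proof. by rewrite /enorm sqr_sqrtr// sumr_ge0// => i _; exact: sqr_ge0. Qed.

Lemma sqnorm_ge0 n (v : 'cV[R]_n) : 0 <= sqnorm v.
Proof. by rewrite sumr_ge0// => i _; exact: sqr_ge0. Qed.

Lemma sqnormE n (v : 'cV[R]_n) : sqnorm v = (v^T *m v) 0 0.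
Proof. by rewrite mxE; apply: eq_bigr => i _; rewrite mxE expr2. Qed.

Lemma sqnorm_eq0 n (v : 'cV[R]_n) : (sqnorm v == 0) = (v == 0).
Proof.
apply/eqP/eqP => [|->]; last by rewrite /sqnorm big1// => i _; rewrite mxE expr0n.
move=> /psumr_eq0P v0; apply/colP => i; rewrite mxE; apply/eqP.
by rewrite -sqrf_eq0; apply/eqP/v0 => // j _; exact: sqr_ge0.
Qed.

Lemma sqnorm_mulmx n p (A : 'M[R]_(n, p)) v : A^T *m A = 1%:M ->
  sqnorm (A *m v) = sqnorm v.
Proof. by move=> AA; rewrite !sqnormE trmx_mul mulmxA -(mulmxA v^T) AA mulmx1. Qed.

Lemma sqnormZ n (a : R) (v : 'cV[R]_n) : sqnorm (a *: v) = a ^+ 2 * sqnorm v.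
Proof. by rewrite /sqnorm mulr_sumr; apply: eq_bigr => i _; rewrite mxE exprMn. Qed.

Lemma sqnormN n (v : 'cV[R]_n) : sqnorm (- v) = sqnorm v.
Proof. by rewrite -scaleN1r sqnormZ sqrrN expr1n mul1r. Qed.

Lemma sqnormD_le n (u v : 'cV[R]_n) :
  sqnorm (u + v) <= 2 * sqnorm u + 2 * sqnorm v.
Proof.
rewrite /sqnorm !mulr_sumr -big_split/=; apply: ler_sum => i _; rewrite mxE.
by rewrite -subr_ge0 (_ : _ - _ = (u i 0 - v i 0) ^+ 2) ?sqr_ge0//; ring.
Qed.

Lemma sqnorm_cons n (x : R) (v : 'cV[R]_n) :
  sqnorm (cons_cV (x : measurableTypeR R, v)) = x ^+ 2 + sqnorm v.
Proof.
rewrite /sqnorm big_ord_recl cons_cV0; congr (_ + _).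
by apply: eq_bigr => i _; rewrite cons_cVS.
Qed.

Lemma measurable_sqnorm n : measurable_fun setT (@sqnorm n).
Proof.
apply: (@measurable_sum _ _ R) => i; apply: (@measurable_funX _ _ R).
exact: measurable_coord.
Qed.

End sqnorm.

Section gaussian.
Context {R : realType}.
Local Open Scope ereal_scope.
Local Notation lam := (@lebesgue_cV R _).

Definition gauss_pdf n (v : 'cV[R]_n) : R :=
  normal_peak 1 ^+ n * expR (- sqnorm v / 2).

Lemma gauss_pdf_ge0 n (v : 'cV[R]_n) : (0 <= gauss_pdf v)%R.
Proof. by rewrite mulr_ge0 ?expR_ge0// exprn_ge0// normal_peak_ge0. Qed.

Lemma gauss_pdf_gt0 n (v : 'cV[R]_n) : (0 < gauss_pdf v)%R.
Proof. by rewrite mulr_gt0 ?expR_gt0// exprn_gt0// normal_peak_gt0// oner_neq0. Qed.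

Lemma measurable_gauss_pdf n : measurable_fun setT (@gauss_pdf n).
Proof.
apply: (@measurable_funM _ _ R) => //; apply: measurableT_comp => //.
apply: (@measurable_funM _ _ R) => //; apply: measurableT_comp => //.
exact: measurable_sqnorm.
Qed.

Lemma measurable_mul_gauss_pdf n (f : 'cV[R]_n -> \bar R) :
  measurable_fun setT f -> measurable_fun setT (fun v => f v * (gauss_pdf v)%:E).
Proof.
move=> mf; apply: emeasurable_funM => //.
by apply/measurable_EFinP; exact: measurable_gauss_pdf.
Qed.

Lemma mul_gauss_pdf_ge0 n (f : 'cV[R]_n -> \bar R) :
  (forall v, 0 <= f v) -> forall v, 0 <= f v * (gauss_pdf v)%:E.
Proof. by move=> f0 v; rewrite mule_ge0// lee_fin gauss_pdf_ge0. Qed.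

Lemma gauss_pdf_cons n (x : R) (v : 'cV[R]_n) :
  gauss_pdf (cons_cV (x : measurableTypeR R, v)) = (normal_pdf 0 1 x * gauss_pdf v)%R.
Proof.
rewrite /gauss_pdf sqnorm_cons normal_pdfE ?oner_neq0// /normal_fun subr0 expr1n.
rewrite exprS mulrACA -expRD; congr (_ * expR _)%R.
by field.
Qed.

Lemma integral_std_normal n (f : 'cV[R]_n -> \bar R) :
  measurable_fun setT f -> (forall v, 0 <= f v) ->
  \int[std_normal]_v f v = \int[lam]_v (f v * (gauss_pdf v)%:E).
Proof.
elim: n f => [|n IH] f mf f0.
  apply: eq_integral => v _.
  rewrite /gauss_pdf expr0 mul1r /sqnorm big_ord0 oppr0 mul0r expR0.
  by rewrite mule1.
have mEg : measurable_fun setT (fun v : 'cV[R]_n.+1 => f v * (gauss_pdf v)%:E).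
  exact: measurable_mul_gauss_pdf.
have fg0 := mul_gauss_pdf_ge0 f0.
rewrite lebesgue_cVS integral_power_measureS// /std_normal.
rewrite (integral_power_measureS (normal_prob 0 1) mf f0).
pose F x := \int[lam]_v (f (cons_cV (x, v)) * (gauss_pdf v)%:E).
transitivity (\int[normal_prob 0 1]_x F x).
  apply: eq_integral => x _.
  rewrite -[LHS]/(\int[std_normal]_v f (cons_cV (x, v))) IH//.
  exact: measurableT_comp mf (measurable_cons_cV2 _).
have mF : measurable_fun setT F.
  apply: (measurable_fun_fubini_tonelli_F (m2 := lam)
    (fun p => f (cons_cV p) * (gauss_pdf p.2)%:E)).
    apply: emeasurable_funM; first exact: measurableT_comp mf (@measurable_cons_cV R n).
    by apply/measurable_EFinP; exact: measurableT_comp (@measurable_gauss_pdf n) measurable_snd.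
  by move=> p; rewrite mule_ge0// lee_fin gauss_pdf_ge0.
have F0 x : 0 <= F x by apply: integral_ge0 => v _; exact: (mul_gauss_pdf_ge0 (f := fun v => f _)).
rewrite (@integral_density _ _ _ lebesgue_measure _ (normal_pdf 0 1))//; last 2 first.
- exact: measurable_normal_pdf.
- by move=> x; exact: normal_pdf_ge0.
apply: eq_integral => x _; rewrite muleC -ge0_integralZl_EFin//; last 3 first.
- by move=> v _; rewrite mule_ge0// lee_fin gauss_pdf_ge0.
- apply: measurable_mul_gauss_pdf; exact: measurableT_comp mf (measurable_cons_cV2 _).
- exact: normal_pdf_ge0.
by apply: eq_integral => v _; rewrite gauss_pdf_cons EFinM muleCA.
Qed.

(** The density depends on the norm only, and |\det O| = 1. *)
Lemma integral_std_normal_orthogonal n (O : 'M[R]_n) (f : 'cV[R]_n -> \bar R) :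
  O^T *m O = 1%:M -> measurable_fun setT f -> (forall v, 0 <= f v) ->
  \int[std_normal]_v f (O *m v) = \int[std_normal]_v f v.
Proof.
move=> OO mf f0; have [_ uO] := mulmx1_unit OO.
rewrite !integral_std_normal//; last exact: measurableT_comp mf (measurable_mulmx O).
have det1 : `|\det O|%R = 1%R.
  apply/eqP; rewrite -sqrp_eq1// real_normK ?num_real//.
  by rewrite expr2 -[X in (X * _)%R]det_tr -det_mulmx OO det1.
have mfg := measurable_mul_gauss_pdf mf.
have fg0 := mul_gauss_pdf_ge0 f0.
rewrite -[RHS]mul1e -[X in X%:E * _]invr1 -det1.
rewrite -(integral_lebesgue_linear uO mfg fg0).
by apply: eq_integral => v _; rewrite /gauss_pdf sqnorm_mulmx.
Qed.

End gaussian.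

(** * Gaussian laws with a given, possibly singular, covariance *)

Lemma exists_unit_orthogonal_row {R : realType} k p (C : 'M[R]_(k, p)) : (k < p)%N ->
  exists d : 'rV[R]_p, C *m d^T = 0 /\ d *m d^T = 1%:M.
Proof.
move=> kp; have ker0 : kermx C^T != 0.
  rewrite -mxrank_eq0 mxrank_ker subn_eq0 -ltnNge.
  exact: leq_ltn_trans (rank_leq_col _) kp.
have [i ri] : exists i, row i (kermx C^T) != 0.
  apply/existsP; apply: contraNT ker0; rewrite negb_exists => /forallP h.
  by apply/eqP/row_matrixP => i; rewrite row0; have := h i; rewrite negbK => /eqP.
set r := row i _ in ri; pose q := sqnorm r^T.
have q0 : 0 < q by rewrite lt_def sqnorm_ge0 sqnorm_eq0 trmx_eq0 ri.
exists ((Num.sqrt q)^-1 *: r); split.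
  apply: trmx_inj; rewrite trmx_mul trmxK trmx0 -scalemxAl -row_mul mulmx_ker.
  by rewrite row0 scaler0.
rewrite [LHS]mx11_scalar -[X in X *m _]trmxK -sqnormE linearZ/= sqnormZ -/q.
by rewrite exprVn sqr_sqrtr ?mulVf ?gt_eqF// ltW.
Qed.

Lemma mulmx_tr_eq0 {R : realType} n p (A : 'M[R]_(n, p)) : A *m A^T = 0 -> A = 0.
Proof.
move=> /matrixP AA; apply/matrixP => i j; rewrite mxE; apply/eqP.
have /psumr_eq0P h : \sum_j A i j ^+ 2 = 0.
  transitivity ((A *m A^T) i i); last by rewrite AA mxE.
  by rewrite mxE; apply: eq_bigr => l _; rewrite mxE expr2.
by rewrite -sqrf_eq0; apply/eqP/h => // l _; exact: sqr_ge0.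
Qed.

Section gaussian_law.
Context {R : realType}.
Local Open Scope ereal_scope.
Local Notation lam := (@lebesgue_cV R _).

Lemma integral_std_normal_tail n (f : 'cV[R]_n -> \bar R) :
  measurable_fun setT f -> (forall v, 0 <= f v) ->
  \int[std_normal]_v f (uncons_cV v).2 = \int[std_normal]_v f v.
Proof.
move=> mf f0.
have mf' : measurable_fun setT (fun v => f (uncons_cV v).2).
  apply: measurableT_comp mf _.
  exact: measurableT_comp measurable_snd (@measurable_uncons_cV R n).
rewrite -[LHS]/(\int[power_measure (normal_prob 0 1) n.+1]_v f (uncons_cV v).2).
rewrite integral_power_measureS//.
transitivity (\int[normal_prob 0 1]_x (cst (\int[std_normal]_v f v) x)).
  apply: eq_integral => x _; apply: eq_integral => v _.
  by rewrite cons_cVK.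
rewrite integral_cst// [X in _ * X](_ : _ = 1) ?mule1//.
exact: probability_setT.
Qed.

(* [C] is completed to an orthogonal matrix by adding unit rows on top, one at a
   time; the first coordinate is the one that [cons_measure] splits off. *)
Lemma integral_std_normal_coisometry k p (C : 'M[R]_(k, p)) (f : 'cV[R]_k -> \bar R) :
  C *m C^T = 1%:M -> measurable_fun setT f -> (forall v, 0 <= f v) ->
  \int[std_normal]_v f (C *m v) = \int[std_normal]_v f v.
Proof.
move: {2}(p - k)%N (leqnn (p - k)%N) => m.
elim: m k C f => [|m IH] k C f pk CC mf f0; have kp := mulmx1_min CC.
  have {kp pk} kp : k = p by apply/eqP; rewrite eqn_leq kp -subn_eq0 -leqn0.
  case: _ / kp C CC => C CC; apply: integral_std_normal_orthogonal => //.
  exact: mulmx1C.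
have [pk'|pk'] := leqP (p - k)%N m; first exact: IH.
have {}kp : (k < p)%N by rewrite -subn_gt0 (leq_trans _ pk').
have [d [Cd dd]] := exists_unit_orthogonal_row C kp.
pose C' : 'M[R]_(k.+1, p) := col_mx d C.
have CC' : C' *m C'^T = 1%:M.
  rewrite /C' (@tr_col_mx _ 1 k) (@mul_col_row _ 1 k _ 1 k) dd CC Cd.
  rewrite (_ : d *m C^T = 0%R) -?(@scalar_mx_block _ 1 k)//.
  by apply: trmx_inj; rewrite trmx_mul trmxK Cd trmx0.
rewrite -[RHS](integral_std_normal_tail mf f0) -(IH _ C')//.
- apply: eq_integral => v _; congr f; apply/colP => i; rewrite [RHS]mxE /C'.
  rewrite (@mul_col_mx _ 1 k) (_ : lift ord0 i = rshift 1 i) ?(@col_mxEd _ 1 k)//.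
  exact: val_inj.
- by rewrite subnS -subn1 leq_subLR.
- apply: measurableT_comp mf _.
  exact: measurableT_comp measurable_snd (@measurable_uncons_cV R k).
Qed.

(** [A] factors as s U C with C = s^-1 U^T A, and C C^T = 1, so that [C] sends a standard normal
    vector to a standard normal vector. This makes the square root picked by [mvnormal]
    irrelevant. *)
Lemma integral_std_normal_cov n k p (U : 'M[R]_(n, k)) (A : 'M[R]_(n, p)) (s : R)
    (f : 'cV[R]_n -> \bar R) :
  (0 < s)%R -> U^T *m U = 1%:M -> A *m A^T = s ^+ 2 *: (U *m U^T) ->
  measurable_fun setT f -> (forall v, 0 <= f v) ->
  \int[std_normal]_v f (A *m v) = \int[std_normal]_v f (s *: (U *m v))%R.
Proof.
move=> s0 UU AA mf f0.
pose C := (s^-1 *: (U^T *m A))%R.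
have AE : A = (s *: (U *m C))%R.
  rewrite /C -scalemxAr scalerA divff ?gt_eqF// scale1r mulmxA.
  (* The difference A - U U^T A vanishes because its product with its own transpose does: U U^T is a
     projection and A A^T is a multiple of it. *)
  apply/eqP; rewrite -subr_eq0; apply/eqP/mulmx_tr_eq0.
  rewrite linearB/= mulmxBl !mulmxBr !trmx_mul trmxK.
  rewrite -!(mulmxA (U *m U^T)) !(mulmxA A) !AA.
  rewrite -!scalemxAl -!scalemxAr -!(mulmxA U) !(mulmxA U^T) UU !mul1mx.
  by rewrite !subrr.
have CC : C *m C^T = 1%:M.
  rewrite /C linearZ/= -scalemxAl -scalemxAr trmx_mul trmxK.
  rewrite -(mulmxA U^T) (mulmxA A) AA -scalemxAl -scalemxAr -(mulmxA U) UU mulmx1 UU.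
  by rewrite !scalerA [X in (X *: _)%R](_ : _ = 1%R) ?scale1r//; field; rewrite gt_eqF.
pose g (z : 'cV[R]_k) := f (s *: (U *m z))%R.
have mg : measurable_fun setT g.
  rewrite /g; under eq_fun do rewrite scalemxAl.
  exact: measurableT_comp mf (measurable_mulmx _).
rewrite -[RHS]/(\int[std_normal]_v g v) -(integral_std_normal_coisometry CC)//.
  by apply: eq_integral => v _; rewrite /g {1}AE -scalemxAl mulmxA.
by move=> v; exact: f0.
Qed.

Lemma integral_mvnormal n k (U : 'M[R]_(n, k)) (S : 'M[R]_n) (s : R) (m : 'cV[R]_n)
    (f : 'cV[R]_n -> \bar R) :
  (0 < s)%R -> U^T *m U = 1%:M -> S = s ^+ 2 *: (U *m U^T) ->
  measurable_fun setT f -> (forall v, 0 <= f v) ->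
  \int[mvnormal m S]_v f v = \int[std_normal]_v f (m + s *: (U *m v))%R.
Proof.
move=> s0 UU SE mf f0; rewrite /mvnormal.
set A := xget _ _.
have AA : A *m A^T = S.
  apply: (@xgetPex _ 0%R [set A : 'M[R]_n | A *m A^T = S]).
  (* U U^T is an orthogonal projection, hence s U U^T is a square root of the covariance, and [xget]
     does not fall back on its default 0. *)
  exists (s *: (U *m U^T))%R => /=.
  rewrite linearZ/= -scalemxAl -scalemxAr scalerA -expr2 trmx_mul trmxK SE.
  by rewrite mulmxA -(mulmxA U) UU mulmx1.
transitivity (\int[std_normal]_v f (m + A *m v)%R).
  exact: (ge0_integral_pushforward (measurable_affine_map m A)).
pose g v := f (m + v)%R.
rewrite SE in AA.
rewrite (@integral_std_normal_cov _ _ _ U A s g)//; last by move=> v; exact: f0.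
exact: measurableT_comp mf (measurable_addc_cV m).
Qed.

Lemma integral_std_normal_affine n (m : 'cV[R]_n) (A : 'M[R]_n)
    (f : 'cV[R]_n -> \bar R) :
  A \in unitmx -> measurable_fun setT f -> (forall v, 0 <= f v) ->
  \int[std_normal]_v f (m + A *m v)%R =
  \int[lam]_v (f v * (`|\det A|^-1 * gauss_pdf (invmx A *m (v - m)))%:E).
Proof.
move=> uA mf f0.
have mfA : measurable_fun setT (fun v => f (m + A *m v)%R).
  exact: measurableT_comp mf (measurable_affine_map m A).
rewrite integral_std_normal//.
pose h v := f (m + v)%R * (gauss_pdf (invmx A *m v))%:E.
have mh : measurable_fun setT h.
  apply: emeasurable_funM; first exact: measurableT_comp mf (measurable_addc_cV m).
  apply/measurable_EFinP.
  exact: measurableT_comp (@measurable_gauss_pdf R n) (measurable_mulmx _).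
have h0 v : 0 <= h v by rewrite mule_ge0// lee_fin gauss_pdf_ge0.
transitivity (\int[lam]_v h (A *m v)).
  by apply: eq_integral => v _; rewrite /h mulKmx.
rewrite integral_lebesgue_linear// -(integral_lebesgue_translate (- m)%R)//.
rewrite -ge0_integralZl_EFin//.
- by apply: eq_integral => v _; rewrite /h addNKr [(- m + _)%R]addrC EFinM muleCA.
- exact: measurableT_comp mh (measurable_addc_cV _).
Qed.

(** Markov's inequality for exp (|z|^2 / 4). Multiplying the standard density by this weight gives
    [gauss_pdf] at z / sqrt 2, and the change of variables by the scalar matrix [A] yields the
    factor (sqrt 2)^n. *)
Lemma std_normal_tail n (t : R) :
  std_normal [set z : 'cV[R]_n | (t < sqnorm z)%R] <=
  (Num.sqrt 2 ^+ n * expR (- t / 4))%:E.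
Proof.
have m2 : measurable_fun setT (fun z : 'cV[R]_n => expR ((sqnorm z - t) / 4)).
  apply: measurableT_comp => //; apply: (@measurable_funM _ _ R) => //.
  by apply: (@measurable_funB _ _ R) => //; exact: measurable_sqnorm.
have mS : measurable [set z : 'cV[R]_n | (t < sqnorm z)%R].
  rewrite -[X in measurable X]setTI (_ : [set z | _] = @sqnorm R n @^-1` `]t, +oo[).
    exact: measurable_sqnorm.
  by apply/seteqP; split => z /=; rewrite in_itv/= andbT.
rewrite -[X in std_normal X]setIT -integral_indic//.
apply: (@le_trans _ _ (\int[std_normal]_z (expR ((sqnorm (z : 'cV[R]_n) - t) / 4))%:E)).
  apply: ge0_le_integral_nonmeasurable => z; first by rewrite lee_fin.
  rewrite lee_fin indicE; case: (boolP (z \in _)) => [|_]; last exact: expR_ge0.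
  rewrite inE/= => tz; rewrite -expR0 ler_expR divr_ge0// subr_ge0; exact: ltW.
rewrite integral_std_normal//; last by apply/measurable_EFinP.
have s2 : (Num.sqrt 2 != 0 :> R)%R by rewrite gt_eqF// sqrtr_gt0.
pose A : 'M[R]_n := (Num.sqrt 2)^-1%:M.
have uA : A \in unitmx by rewrite unitmxE det_scalar unitfE expf_neq0// invr_eq0.
have I1 : \int[lam]_z (gauss_pdf (z : 'cV[R]_n))%:E = 1.
  transitivity (\int[std_normal]_z (cst 1 (z : 'cV[R]_n))).
    by rewrite integral_std_normal//; apply: eq_integral => z _; rewrite mul1e.
  by rewrite integral_cst// mul1e; exact: probability_setT.
have detA : (`|\det A|^-1 = Num.sqrt 2 ^+ n)%R.
  by rewrite det_scalar normrX ger0_norm ?invr_ge0// exprVn invrK.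
have -> : (Num.sqrt 2 ^+ n * expR (- t / 4))%:E =
    (expR (- t / 4))%:E * \int[lam]_z (gauss_pdf (A *m (z : 'cV[R]_n)))%:E.
  rewrite (@integral_lebesgue_linear R n A (fun z => (gauss_pdf z)%:E))//.
  - by rewrite I1 detA mule1 -EFinM mulrC.
  - by apply/measurable_EFinP; exact: measurable_gauss_pdf.
  - by move=> v; rewrite lee_fin gauss_pdf_ge0.
have g0 v : setT v -> 0 <= (gauss_pdf (A *m v))%:E.
  by move=> _; rewrite lee_fin gauss_pdf_ge0.
have mg : measurable_fun setT (fun v : 'cV[R]_n => (gauss_pdf (A *m v))%:E).
  apply/measurable_EFinP.
  exact: measurableT_comp (@measurable_gauss_pdf R n) (measurable_mulmx A).
rewrite -(ge0_integralZl_EFin _ measurableT g0 mg (expR_ge0 _)).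
rewrite le_eqVlt; apply/orP; left; apply/eqP/eq_integral => z _; rewrite -!EFinM; congr EFin.
rewrite /gauss_pdf mul_scalar_mx sqnormZ (exprVn (Num.sqrt 2)) sqr_sqrtr//.
rewrite mulrCA [RHS]mulrCA; congr (_ * _)%R; rewrite -!expRD; congr expR.
by field.
Qed.

End gaussian_law.

(** * QR factorisation *)

Section QR.
Context {R : realType}.

(** Induction on the size: the Schur complement of the top left entry is again symmetric and
    positive definite. *)
Lemma cholesky k (S : 'M[R]_k) : S^T = S ->
  (forall x : 'cV[R]_k, x != 0 -> 0 < (x^T *m S *m x) 0 0) ->
  exists T : 'M[R]_k, T^T *m T = S.
Proof.
elim: k S => [|k IH] S ST Spos.
  by exists 0; rewrite mulmx0 [RHS]flatmx0.
have : S = block_mx (@ulsubmx _ 1 k 1 k S) (@ursubmx _ 1 k 1 k S)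
                    (@dlsubmx _ 1 k 1 k S) (@drsubmx _ 1 k 1 k S) by rewrite submxK.
set a := ulsubmx _; set r := ursubmx _; set c := dlsubmx _; set D := drsubmx _ => SE.
have := ST; rewrite SE (@tr_block_mx _ 1 k 1 k) => /(@eq_block_mx _ 1 k 1 k)[_ _ cE DT].
pose al := a 0 0; have aE : a = al%:M by rewrite [a]mx11_scalar.
have quad (u : R) (x : 'cV[R]_k) :
    let y : 'cV[R]_k.+1 := col_mx u%:M x in
    (y^T *m S *m y) 0 0 = al * u ^+ 2 + 2 * u * (r *m x) 0 0 + (x^T *m D *m x) 0 0.
  rewrite /= SE (@tr_col_mx _ 1 k) (@mul_row_block _ 1 1 k 1 k).
  rewrite (@mul_row_col _ 1 1 k) -cE aE !tr_scalar_mx !mulmxDl.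
  rewrite !mul_scalar_mx !mul_mx_scalar -trmx_mul -scalemxAl.
  set p := r *m x; set q := x^T *m D *m x.
  rewrite [p]mx11_scalar [q]mx11_scalar tr_scalar_mx !mxE !mulr1n/=.
  by ring.
have al0 : 0 < al.
  have := Spos (col_mx 1%:M 0 : 'cV[R]_(1 + k)).
  rewrite quad !mulmx0 !mxE expr1n mulr1 mulr0 !addr0; apply.
  rewrite -(@col_mx0 _ 1 k 1); apply/eqP => /(@eq_col_mx _ 1 k)[/matrixP/(_ 0 0)].
  rewrite !mxE => /eqP.
  by rewrite oner_eq0.
have [|x x0|T' T'E] := IH (D - al^-1 *: (r^T *m r)).
- by rewrite linearB linearZ/= trmx_mul trmxK DT.
(* This [u] minimises the quadratic form of [S] at (u, x); the minimum is the form of the Schur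
   complement at [x]. *)
- pose u := - (r *m x) 0 0 / al.
  have := Spos (col_mx u%:M x : 'cV[R]_(1 + k)); rewrite quad => pos.
  rewrite (_ : _ 0 0 = (x^T *m D *m x) 0 0 - al^-1 * (r *m x) 0 0 ^+ 2); last first.
    rewrite mulmxBr mulmxBl mxE; congr (_ + _).
    rewrite mxE -scalemxAr -scalemxAl mxE; congr (- (_ * _)).
    by rewrite (mulmxA x^T) -(mulmxA _ r) -trmx_mul mxE big_ord1 mxE expr2.
  set p := r *m x in u pos *; set q := (_ *m D *m x) 0 0 in pos *.
  rewrite (_ : q - _ = al * u ^+ 2 + 2 * u * p 0 0 + q).
    apply: pos; rewrite -(@col_mx0 _ 1 k 1); apply/eqP => /(@eq_col_mx _ 1 k)[_ /eqP]; exact/negP.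
  by rewrite /u; field; rewrite gt_eqF.
- have sal : Num.sqrt al != 0 by rewrite gt_eqF// sqrtr_gt0.
  have trE : ((Num.sqrt al)^-1 *: r)^T = (Num.sqrt al)^-1 *: r^T by rewrite linearZ.
  exists (block_mx (Num.sqrt al)%:M ((Num.sqrt al)^-1 *: r) 0 T' : 'M[R]_(1 + k)).
  rewrite (@tr_block_mx _ 1 k 1 k) (@mulmx_block _ 1 k 1 k 1 k).
  rewrite !trmx0 !mulmx0 !mul0mx !addr0 tr_scalar_mx -scalar_mxM -expr2.
  rewrite sqr_sqrtr ?(ltW al0)// T'E trE mul_scalar_mx mul_mx_scalar.
  rewrite !scalerA mulfV// !scale1r -scalemxAl -scalemxAr scalerA -invfM -expr2.
  by rewrite sqr_sqrtr ?(ltW al0)// addrCA subrr addr0 cE -aE.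
Qed.

(** If K Phi^T Phi = 0, then K Phi^T times its own transpose is 0, so K Phi^T = 0, and K = 0 since
    the rows of Phi^T are free. *)
Lemma gram_unitmx n k (Phi : 'M[R]_(n, k)) : \rank Phi = k ->
  Phi^T *m Phi \in unitmx.
Proof.
move=> rPhi; have free : row_free Phi^T by rewrite /row_free mxrank_tr rPhi.
rewrite -row_free_unit -kermx_eq0; set K := kermx _.
rewrite -(mulmx_free_eq0 _ free); apply/eqP/mulmx_tr_eq0.
by rewrite trmx_mul trmxK mulmxA -(mulmxA K) mulmx_ker mul0mx.
Qed.

(** With [T] the Cholesky factor of Phi^T Phi, the columns of Phi T^-1 are orthonormal. The
    conclusion collects all that is used of [Phi] later on; its last clause is the source of the
    determinant in hypothesis (3). *)
Lemma exists_QR n k (Phi : 'M[R]_(n, k)) : \rank Phi = k ->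
  exists U : 'M[R]_(n, k), exists T : 'M[R]_k,
    [/\ U^T *m U = 1%:M, T \in unitmx, Phi = U *m T, hat_mx Phi = U *m U^T &
        (forall F, ls_coef Phi F = invmx T *m (U^T *m F)) /\
        `|\det T| = Num.sqrt (\det (Phi^T *m Phi))].
Proof.
move=> rPhi; have uS := gram_unitmx rPhi.
have free : row_free Phi^T by rewrite /row_free mxrank_tr rPhi.
have [||T TE] := @cholesky k (Phi^T *m Phi).
- by rewrite trmx_mul trmxK.
- move=> x x0; rewrite mulmxA -mulmxA -trmx_mul -sqnormE lt_def sqnorm_ge0 andbT.
  rewrite sqnorm_eq0 -trmx_eq0 trmx_mul (mulmx_free_eq0 _ free) trmx_eq0.
  exact: x0.
have uT : T \in unitmx by move: uS; rewrite -TE unitmx_mul => /andP[].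
have uTt : T^T \in unitmx by rewrite unitmx_tr.
have invE : invmx (Phi^T *m Phi) = invmx T *m (invmx T)^T.
  apply: (can_inj (mulKmx uS)); rewrite mulmxV// -TE mulmxA -(mulmxA T^T) mulmxV//.
  by rewrite mulmx1 -trmx_mul mulVmx// trmx1.
exists (Phi *m invmx T), T; split => //.
- rewrite trmx_mul mulmxA -(mulmxA _ Phi^T) -TE mulmxA -trmx_mul mulmxV//.
  by rewrite trmx1 mul1mx mulmxV.
- by rewrite mulmxKV.
- by rewrite /hat_mx invE trmx_mul !mulmxA.
split=> [F|]; first by rewrite /ls_coef invE trmx_mul !mulmxA.
by rewrite -TE det_mulmx det_tr -expr2 sqrtr_sqr.
Qed.

End QR.

(** * Measures on column vectors and total variation *)

Section boxes.
Context {R : realType} {n : nat}.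

(** Lower orthants with rational corners: a generating family closed under intersection. Indexing it
    by [ffun] makes the index type countable, so that [unpickle] can enumerate it. *)
Definition box (r : {ffun 'I_n -> rat}) : set 'cV[R]_n :=
  [set v | forall i, v i 0 < ratr (r i)].

Lemma boxI r1 r2 : box r1 `&` box r2 = box [ffun i => Order.min (r1 i) (r2 i)].
Proof.
apply/seteqP; split => v /=.
  by move=> [h1 h2] i; rewrite ffunE /Order.min; case: ifP => _; [exact: h1|exact: h2].
move=> h; split => i; apply: lt_le_trans (h i) _; rewrite ffunE ler_rat.
  by rewrite ge_min lexx.
by rewrite ge_min lexx orbT.
Qed.

Lemma box_cover : \bigcup_m box [ffun=> m%:R] = setT.
Proof.
rewrite -subTset => v _.
exists (Num.truncn (\sum_(i < n) `|v i 0|)).+1 => // i; rewrite ffunE ratr_nat.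
apply: le_lt_trans (truncnS_gt _); apply: le_trans (ler_norm _) _.
by rewrite (bigD1 i)//= lerDl sumr_ge0.
Qed.

Lemma measurable_cVE :
  (measurable : set (set 'cV[R]_n)) = <<s range box >>.
Proof.
apply/seteqP; split; last first.
  apply: smallest_sub; first exact: sigma_algebra_measurable.
  move=> _ [r _ <-].
  rewrite (_ : box r = \bigcap_(i in [set: 'I_n])
      ((fun v : 'cV[R]_n => v i 0 : measurableTypeR R) @^-1` `]-oo, ratr (r i)[)).
    apply: fin_bigcap_measurable => // i _.
    by rewrite -[X in measurable X]setTI; exact: measurable_coord.
  apply/seteqP; split => v /= h i; last by have := h i I; rewrite /= in_itv.
  by move=> _; rewrite /= in_itv/=; exact: h.
have sG := smallest_sigma_algebra [set: 'cV[R]_n] (range box).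
apply: smallest_sub => // A; rewrite -bigcup_seq => -[i _ [B mB <-]] /=.
have {}mB : (@RGenInftyO.G R).-sigma.-measurable B.
  by rewrite -RGenInftyO.measurableE.
rewrite setTI; move: B mB.
apply: smallest_sub.
  split; first by rewrite /= preimage_set0; case: sG.
    by move=> C; rewrite /= setTD preimage_setC -setTD; case: sG => _ + _; apply.
  by move=> F mF; rewrite /= preimage_bigcup; case: sG => _ _; apply.
move=> _ [x ->] /=.
(* The rationals q < x exhaust the half-line in coordinate [i], and the corners [m] exhaust the
   other coordinates. *)
rewrite (_ : _ @^-1` _ = \bigcup_(q in [set: rat]) \bigcup_m
    (if ratr q < x then box [ffun j => if j == i then q else m%:R] else set0)).
  apply: (@bigcupT_measurable_rat _ (g_sigma_algebraType (range box))) => q.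
  apply: bigcupT_measurable => m.
  case: ifP => _; last exact: measurable0.
  by apply: sub_sigma_algebra; exists [ffun j => if j == i then q else m%:R].
apply/seteqP; split => v /=; rewrite in_itv/=.
  move=> /rat_in_itvoo[q]; rewrite in_itv/= => /andP[vq qx].
  have : (\bigcup_m box [ffun=> m%:R]) v by rewrite box_cover.
  move=> [m _ vm]; exists q => //; exists m => //; rewrite qx => j; rewrite ffunE.
  by case: eqP => [->//|_]; have := vm j; rewrite ffunE.
move=> [q _ [m _]]; case: ifP => // qx /(_ i); rewrite ffunE eqxx => /lt_trans; exact.
Qed.

Lemma measure_cV_unique (m1 m2 : {measure set 'cV[R]_n -> \bar R}) :
  (m1 setT < +oo)%E -> (forall r, m1 (box r) = m2 (box r)) ->
  forall A, measurable A -> m1 A = m2 A.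
Proof.
move=> m1oo m12 A mA.
apply: (@measure_unique _ _ _ (range box) (fun m => box [ffun=> m%:R])) => //.
- exact: measurable_cVE.
- move=> _ _ [r1 _ <-] [r2 _ <-]; rewrite boxI.
  by exists [ffun i => Order.min (r1 i) (r2 i)].
- exact: box_cover.
- by move=> _ [r _ <-].
- move=> m; apply: le_lt_trans m1oo; apply: le_measure; rewrite ?inE//.
  by rewrite measurable_cVE; apply: sub_sigma_algebra; exists [ffun=> m%:R].
Qed.

End boxes.

Definition density_measure d (T : measurableType d) (R : realType)
  (mu : {measure set T -> \bar R}) (f : T -> \bar R) : set T -> \bar R :=
  fun A => (\int[mu]_(x in A) f x)%E.

Section density_measure.
Local Open Scope ereal_scope.
Context d (T : measurableType d) (R : realType).
Variables (mu : {measure set T -> \bar R}) (f : T -> \bar R).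
Hypotheses (mf : measurable_fun setT f) (f0 : forall x, 0 <= f x).

Let density_measure0 : density_measure mu f set0 = 0.
Proof. exact: integral_set0. Qed.

Let density_measure_ge0 A : 0 <= density_measure mu f A.
Proof. by apply: integral_ge0 => x _; exact: f0. Qed.

Let density_measure_sigma_additive : semi_sigma_additive (density_measure mu f).
Proof.
move=> F mF tF mUF; rewrite /density_measure ge0_integral_bigcup//; last first.
  exact: measurable_funTS.
by apply: is_cvg_ereal_nneg_natsum_cond => n _ _; exact: density_measure_ge0.
Qed.

HB.instance Definition _ := isMeasure.Build _ _ _ (density_measure mu f)
  density_measure0 density_measure_ge0 density_measure_sigma_additive.

Definition mdensity : {measure set T -> \bar R} := density_measure mu f.

End density_measure.

(** * Total variation from two-sided bounds on an unnormalised measure *)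

Section tv_bound.
Context d (T : measurableType d) (R : realType).
Variables (Q nu : {measure set T -> \bar R}) (B : set T) (a b del eta : R).
Hypotheses (mB : measurable B) (QT : Q setT = 1%E) (nuT : (nu setT < +oo)%E).
Hypotheses (a0 : 0 < a) (ab : a <= b) (del0 : 0 <= del) (del1 : del < 1).
Hypothesis QB : (Q (~` B) <= del%:E)%E.
Hypothesis nuB : (nu (~` B) <= eta%:E)%E.
Hypothesis le_nu : forall S, measurable S -> S `<=` B -> (a%:E * Q S <= nu S)%E.
Hypothesis ge_nu : forall S, measurable S -> S `<=` B -> (nu S <= b%:E * Q S)%E.

Let Qfin S : measurable S -> Q S \is a fin_num.
Proof.
move=> mS; rewrite ge0_fin_numE//; apply: (@le_lt_trans _ _ 1%E); last exact: ltry.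
by rewrite -QT le_measure ?inE.
Qed.

Let nufin S : measurable S -> nu S \is a fin_num.
Proof.
move=> mS; rewrite ge0_fin_numE//; apply: le_lt_trans nuT.
by rewrite le_measure ?inE.
Qed.

Let qS S := fine (Q S).
Let nS S := fine (nu S).

Let qE S : measurable S -> Q S = (qS S)%:E. Proof. by move=> mS; rewrite fineK ?Qfin. Qed.
Let nE S : measurable S -> nu S = (nS S)%:E. Proof. by move=> mS; rewrite fineK ?nufin. Qed.

Let mBC : measurable (~` B). Proof. exact: measurableC. Qed.

Let nu_total : a * (1 - del) <= nS setT.
Proof.
have qB : 1 - del <= qS B.
  have : Q setT = (Q B + Q (~` B))%E.
    by rewrite -(setUv B) measureU// ?setICr.
  rewrite QT !qE// -EFinD => -[E]; move: QB; rewrite qE// lee_fin => h.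
  by rewrite E; lra.
have := le_nu mB (@subset_refl _ B); rewrite qE// nE// -EFinM lee_fin => h.
have nBT : nS B <= nS setT by rewrite -lee_fin -!nE// le_measure ?inE.
by apply: le_trans nBT; apply: le_trans h; rewrite ler_pM2l.
Qed.

Let nu_up S : measurable S -> nS S <= b * qS S + eta.
Proof.
move=> mS; have mSB : measurable (S `&` B) by exact: measurableI.
have mSB' : measurable (S `&` ~` B) by exact: measurableI.
have : nu S = (nu (S `&` B) + nu (S `&` ~` B))%E.
  rewrite -measureU//; first by rewrite -setIUr setUv setIT.
  by rewrite setIACA setICr setI0.
rewrite !nE// -EFinD => -[->]; apply: lerD.
  have := ge_nu mSB (@subIsetr _ S B).
  rewrite nE// qE// -EFinM lee_fin => /le_trans; apply.
  by rewrite ler_pM2l ?(lt_le_trans a0)// -lee_fin -!qE// le_measure ?inE.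
rewrite -lee_fin -nE//; apply: le_trans nuB; by rewrite le_measure ?inE.
Qed.

(** Write D = a (1 - del), a lower bound for the total mass of [nu], and q = Q S. Then p - q <= (b q
    + eta) / D - q, which is largest at q = 1 because D <= b. *)
Let one_side S p : measurable S -> 0 <= p <= 1 -> p * nS setT = nS S ->
  p - qS S <= (b + eta) / (a * (1 - del)) - 1.
Proof.
move=> mS /andP[p0 p1] pE.
have D0 : 0 < a * (1 - del) by rewrite mulr_gt0// subr_gt0.
have q0 : 0 <= qS S by rewrite fine_ge0.
have q1 : qS S <= 1 by rewrite -lee_fin -qE// -QT le_measure ?inE.
have h1 : p * (a * (1 - del)) <= b * qS S + eta.
  by apply: le_trans (nu_up mS); rewrite -pE ler_wpM2l.
rewrite lerBrDr ler_pdivlMr//.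
have : a * (1 - del) <= b by apply: le_trans _ ab; rewrite ler_piMr ?(ltW a0)// lerBlDr lerDl.
set D := a * (1 - del) in D0 h1 * => Db.
suff : (1 - qS S) * D <= (1 - qS S) * b by nra.
by rewrite ler_wpM2l// subr_ge0.
Qed.

(** The opposite inequality is [one_side] for the complement of [S] and 1 - p. That [p] is the
    normalised mass of [S] is expressed by a product, so nothing is divided in the extended
    reals. *)
Lemma tv_bound S (p : R) : measurable S -> 0 <= p <= 1 ->
  (p%:E * nu setT = nu S)%E ->
  (`|p%:E - Q S| <= ((b + eta) / (a * (1 - del)) - 1)%:E)%E.
Proof.
move=> mS p01; rewrite qE// !nE// -EFinM -EFinB /= => -[pE].
rewrite lee_fin ler_norml (one_side mS p01 pE) andbT lerNl opprB.
have mSC : measurable (~` S) by exact: measurableC.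
have nSC : nS setT = nS S + nS (~` S).
  apply: EFin_inj; rewrite EFinD -!nE//.
  by rewrite -measureU// ?setUv// setICr.
have qSC : 1 = qS S + qS (~` S).
  apply: EFin_inj; rewrite EFinD -!qE//.
  by rewrite -measureU// ?setUv// setICr.
have := @one_side (~` S) (1 - p) mSC.
rewrite mulrBl mul1r pE {1}nSC addrAC subrr add0r => /(_ _ erefl) h.
rewrite (_ : qS S - p = 1 - p - qS (~` S)); last by rewrite qSC; ring.
by apply: h; case/andP: p01 => ? ?; apply/andP; split; lra.
Qed.

End tv_bound.

(** * The posterior *)

Section measurable_vector.
Context {R : realType} d (X : measurableType d).

Lemma measurable_cVB n (f g : X -> 'cV[R]_n) :
  measurable_fun setT f -> measurable_fun setT g ->
  measurable_fun setT (fun x => f x - g x).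
Proof.
move=> mf mg; apply: measurable_fun_cVP => i; under eq_fun do rewrite mxE mxE.
apply: (@measurable_funB _ _ R).
- exact: measurableT_comp (@measurable_coord R n i) mf.
- exact: measurableT_comp (@measurable_coord R n i) mg.
Qed.

Lemma measurable_cVZ n (a : R) (f : X -> 'cV[R]_n) :
  measurable_fun setT f -> measurable_fun setT (fun x => a *: f x).
Proof.
move=> mf; under eq_fun do rewrite -mul_scalar_mx.
exact: measurableT_comp (@measurable_mulmx R _ _ _) mf.
Qed.

Lemma measurable_cVM n p (A : 'M[R]_(n, p)) (f : X -> 'cV[R]_p) :
  measurable_fun setT f -> measurable_fun setT (fun x => A *m f x).
Proof. by move=> mf; exact: measurableT_comp (@measurable_mulmx R _ _ _) mf. Qed.

End measurable_vector.

(** * Densities of the likelihood and of the target *)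

Section gaussian_models.
Context {R : realType}.
Variables (n k : nat) (U : 'M[R]_(n, k)) (T : 'M[R]_k) (s : R).
Hypotheses (s0 : 0 < s) (UU : U^T *m U = 1%:M) (uT : T \in unitmx).
Local Notation lam := (@lebesgue_cV R _).
Local Notation peak := (@normal_peak R 1).

Definition iso_pdf m (s : R) (mu y : 'cV[R]_m) : R :=
  s^-1 ^+ m * gauss_pdf (s^-1 *: (y - mu)).

(** The density q_y of the overview. *)
Definition ls_pdf (y : 'cV[R]_n) (th : 'cV[R]_k) : R :=
  `|\det T| * s^-1 ^+ k * gauss_pdf (s^-1 *: (T *m th - U^T *m y)).

(* The factor of the likelihood that is free of theta, see [iso_pdf_factor]: it
   cancels in Bayes' formula. *)
Definition resid_pdf (y : 'cV[R]_n) : R :=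
  s^-1 ^+ n * gauss_pdf (s^-1 *: (y - U *m (U^T *m y))) /
  (`|\det T| * s^-1 ^+ k * peak ^+ k).

Let detT0 : 0 < `|\det T|. Proof. by rewrite normr_gt0 -unitfE -unitmxE. Qed.
Let is0 m : 0 < s^-1 ^+ m. Proof. by rewrite exprn_gt0// invr_gt0. Qed.
Let peak0 : 0 < peak. Proof. by rewrite normal_peak_gt0// oner_neq0. Qed.

Lemma ls_pdf_gt0 y th : 0 < ls_pdf y th.
Proof. by rewrite mulr_gt0 ?gauss_pdf_gt0// mulr_gt0. Qed.

Lemma resid_pdf_gt0 y : 0 < resid_pdf y.
Proof.
rewrite divr_gt0//; first by rewrite mulr_gt0 ?gauss_pdf_gt0.
by rewrite mulr_gt0 ?exprn_gt0// mulr_gt0.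
Qed.

Lemma iso_pdf_ge0 m (mu y : 'cV[R]_m) : 0 <= iso_pdf s mu y.
Proof. by rewrite ltW// mulr_gt0// gauss_pdf_gt0. Qed.

Let sqnorm_pythagoras (a : 'cV[R]_n) (b : 'cV[R]_k) : U^T *m a = 0 ->
  sqnorm (a + U *m b) = sqnorm a + sqnorm b.
Proof.
move=> Ua; have aU : a^T *m U = 0 by apply: trmx_inj; rewrite trmx_mul trmxK Ua trmx0.
rewrite !sqnormE [(a + _)^T]linearD/= trmx_mul mulmxDl !mulmxDr -mulmxA Ua mulmx0 add0r.
rewrite (mulmxA a^T) aU mul0mx addr0 -mulmxA (mulmxA U^T) UU mul1mx mxE.
by [].
Qed.

(** Pythagoras: the residual y - U U^T y is orthogonal to the columns of [U], so |y - U T theta|^2 =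
    |y - U U^T y|^2 + |T theta - U^T y|^2. *)
Lemma iso_pdf_factor y th :
  iso_pdf s (U *m T *m th) y = resid_pdf y * ls_pdf y th.
Proof.
rewrite /iso_pdf /resid_pdf /ls_pdf /gauss_pdf.
set r := sqnorm (s^-1 *: (y - U *m (U^T *m y))).
set e := sqnorm (s^-1 *: (T *m th - U^T *m y)).
have -> : sqnorm (s^-1 *: (y - U *m T *m th)) = r + e.
  rewrite /r /e !sqnormZ -mulrDr; congr (_ * _).
  rewrite -[sqnorm (T *m th - _)]sqnormN opprB -sqnorm_pythagoras.
    by rewrite mulmxBr addrA subrK -mulmxA.
  by rewrite mulmxBr (mulmxA U^T) UU mul1mx subrr.
rewrite opprD mulrDl expRD.
(* Stated over abstract reals so that [field] sees the powers and exponentials as atoms. *)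
have alg (a p c e' D b q : R) : D != 0 -> b != 0 -> q != 0 ->
    a * (p * (c * e')) = a * (p * c) / (D * b * q) * (D * b * (q * e')).
  by move=> D0 b0 q0; field; rewrite D0 b0 q0.
by apply: alg; rewrite gt_eqF// exprn_gt0.
Qed.

Lemma ls_pdf_le y th t : t * s ^+ 2 <= sqnorm (T *m th - U^T *m y) ->
  ls_pdf y th <= `|\det T| * s^-1 ^+ k * peak ^+ k * expR (- t / 2).
Proof.
move=> h; rewrite /ls_pdf /gauss_pdf mulrA ler_pM2l; last first.
  by rewrite mulr_gt0 ?exprn_gt0// mulr_gt0.
rewrite ler_expR ler_pM2r ?invr_gt0// lerN2 sqnormZ exprVn.
by rewrite ler_pdivlMl ?exprn_gt0// mulrC.
Qed.

Lemma ls_pdf_ub y th : ls_pdf y th <= `|\det T| * s^-1 ^+ k * peak ^+ k.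
Proof.
have := @ls_pdf_le y th 0; rewrite mul0r oppr0 mul0r expR0 mulr1; apply.
exact: sqnorm_ge0.
Qed.

Lemma measurable_ls_pdf :
  measurable_fun setT (fun p : 'cV[R]_n * 'cV[R]_k => ls_pdf p.1 p.2).
Proof.
apply: (@measurable_funM _ _ R) => //.
apply: measurableT_comp (@measurable_gauss_pdf R k) _; apply: measurable_cVZ.
by apply: measurable_cVB; apply: measurable_cVM;
  [exact: measurable_snd|exact: measurable_fst].
Qed.

Lemma measurable_ls_pdf2 y : measurable_fun setT (ls_pdf y).
Proof. exact: measurableT_comp measurable_ls_pdf (pair1_measurable y). Qed.

Lemma measurable_iso_pdf m :
  measurable_fun setT (fun p : 'cV[R]_m * 'cV[R]_m => iso_pdf s p.1 p.2).
Proof.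
apply: (@measurable_funM _ _ R) => //.
apply: measurableT_comp (@measurable_gauss_pdf R m) _; apply: measurable_cVZ.
by apply: measurable_cVB; [exact: measurable_snd|exact: measurable_fst].
Qed.

Lemma measurable_resid_pdf : measurable_fun setT resid_pdf.
Proof.
apply: (@measurable_funM _ _ R) => //; apply: (@measurable_funM _ _ R) => //.
apply: measurableT_comp (@measurable_gauss_pdf R n) _; apply: measurable_cVZ.
by apply: measurable_cVB => //; do 2 apply: measurable_cVM.
Qed.

Local Open Scope ereal_scope.

Lemma integral_mvnormal_iso m (mu : 'cV[R]_m) (f : 'cV[R]_m -> \bar R) :
  measurable_fun setT f -> (forall v, 0 <= f v) ->
  \int[mvnormal mu (s ^+ 2)%:M]_y f y = \int[lam]_y (f y * (iso_pdf s mu y)%:E).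
Proof.
move=> mf f0.
rewrite (@integral_mvnormal _ _ _ (1%:M : 'M[R]_m) _ s)//; last 2 first.
- by rewrite trmx1 mulmx1.
- by rewrite trmx1 mulmx1 scalemx1.
transitivity (\int[std_normal]_v f (mu + s%:M *m v)%R).
  by apply: eq_integral => v _; rewrite mul1mx -mul_scalar_mx.
have us : (s%:M : 'M[R]_m) \in unitmx.
  by rewrite unitmxE det_scalar unitfE expf_neq0// gt_eqF.
rewrite (@integral_std_normal_affine R m mu s%:M f us mf f0).
apply: eq_integral => y _.
by rewrite invmx_scalar mul_scalar_mx det_scalar normrX gtr0_norm// -exprVn.
Qed.

(** A vector with the target law is U T theta for theta = T^-1 (U^T y + s Z), with Z standard normal
    on R^k; unlike the target itself, theta has a density in every case. *)
Lemma integral_mvnormal_hat y (f : 'cV[R]_n -> \bar R) :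
  measurable_fun setT f -> (forall v, 0 <= f v) ->
  \int[mvnormal (U *m U^T *m y) (s ^+ 2 *: (U *m U^T))]_v f v =
  \int[lam]_th (f (U *m T *m th) * (ls_pdf y th)%:E).
Proof.
move=> mf f0; rewrite (@integral_mvnormal _ _ _ U _ s)//.
pose A := (s *: invmx T)%R; pose g th := f (U *m T *m th).
have uA : A \in unitmx by rewrite unitmxZ ?unitmx_inv// unitfE gt_eqF.
have iA : invmx A = (s^-1 *: T)%R.
  apply: (can_inj (mulKmx uA)); rewrite mulmxV// -scalemxAl -scalemxAr mulVmx//.
  by rewrite scalerA divff ?scale1r// gt_eqF.
transitivity (\int[std_normal]_v g (invmx T *m (U^T *m y) + A *m v)%R).
  apply: eq_integral => v _; rewrite /g; congr f.
  rewrite mulmxDr -!(mulmxA U) mulKVmx// /A -scalemxAl.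
  by rewrite -!scalemxAr mulKVmx.
have mg : measurable_fun setT g by exact: measurableT_comp mf (measurable_mulmx _).
have g0 th : 0 <= g th by exact: f0.
rewrite (@integral_std_normal_affine R k _ A g uA mg g0).
apply: eq_integral => th _; congr (_ * _%:E); rewrite /ls_pdf iA.
have -> : (s^-1 *: T) *m (th - invmx T *m (U^T *m y)) = (s^-1 *: (T *m th - U^T *m y))%R.
  by rewrite -scalemxAl mulmxBr mulKVmx.
congr (_ * _)%R.
by rewrite detZ det_inv normrM normrX normfV (gtr0_norm s0) invfM invrK mulrC exprVn.
Qed.

End gaussian_models.

(** * Bayes' formula and the version of the posterior *)

Section posterior.
Context {R : realType}.
Variables (n k : nat) (U : 'M[R]_(n, k)) (T : 'M[R]_k) (s : R).
Hypotheses (s0 : 0 < s) (UU : U^T *m U = 1%:M) (uT : T \in unitmx).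
Variables (W : probability 'cV[R]_k R) (w : 'cV[R]_k -> R).
Hypothesis Ww : has_density W w.
Local Notation lam := (@lebesgue_cV R _).
Local Notation Phi := (U *m T).
Local Notation ls_pdf := (ls_pdf U T s).
Local Notation resid_pdf := (resid_pdf U T s).
Local Open Scope ereal_scope.

Let mw : measurable_fun setT w. Proof. by case: Ww. Qed.
Let w0 x : (0 <= w x)%R. Proof. by case: Ww. Qed.

Definition post_pdf (y : 'cV[R]_n) (th : 'cV[R]_k) : \bar R :=
  (w th * ls_pdf y th)%:E.

Lemma post_pdf_ge0 y th : 0 <= post_pdf y th.
Proof. by rewrite lee_fin mulr_ge0// ltW// ls_pdf_gt0. Qed.

Let measurable_post_pdf :
  measurable_fun setT (fun p : 'cV[R]_n * 'cV[R]_k => post_pdf p.1 p.2).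
Proof.
apply/measurable_EFinP; apply: (@measurable_funM _ _ R); last first.
  exact: measurable_ls_pdf.
exact: measurableT_comp mw measurable_snd.
Qed.

Lemma measurable_post_pdf2 y : measurable_fun setT (post_pdf y).
Proof. exact: measurableT_comp measurable_post_pdf (pair1_measurable y). Qed.

Let mPhi : measurable_fun setT (mulmx Phi : 'cV[R]_k -> 'cV[R]_n) := measurable_mulmx Phi.

Section bayes.
Variables (a b : 'cV[R]_n -> \bar R).
Hypotheses (ma : measurable_fun setT a) (a0 : forall v, 0 <= a v).
Hypotheses (mb : measurable_fun setT b) (b0 : forall v, 0 <= b v).

(** Tonelli's theorem for the joint law of (theta, y), with the likelihood split by
    [iso_pdf_factor]. General [a] and [b] are allowed because the kernel itself appears in [b] when
    [is_posterior] is rewritten. *)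
Lemma bayes_integral :
  \int[distribution W (mulmx Phi)]_f
     (a f * \int[mvnormal f (s ^+ 2)%:M]_y b y) =
  \int[lam]_y (b y * ((resid_pdf y)%:E *
     \int[lam]_th (a (Phi *m th) * post_pdf y th))).
Proof.
pose H f := \int[lam]_y (b y * (iso_pdf s f y)%:E).
have mbi : measurable_fun setT
    (fun p : 'cV[R]_n * 'cV[R]_n => b p.2 * (iso_pdf s p.1 p.2)%:E).
  apply: emeasurable_funM; first exact: measurableT_comp mb measurable_snd.
  by apply/measurable_EFinP; exact: measurable_iso_pdf.
have bi0 f y : 0 <= b y * (iso_pdf s f y)%:E.
  by rewrite mule_ge0// lee_fin iso_pdf_ge0.
have mH : measurable_fun setT H.
  apply: (measurable_fun_fubini_tonelli_F (m2 := lam) _ mbi).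
  by move=> p; exact: bi0.
have H0 f : 0 <= H f by apply: integral_ge0 => y _; exact: bi0.
have maH : measurable_fun setT (fun f => a f * H f) by exact: emeasurable_funM.
have aH0 f : 0 <= a f * H f by exact: mule_ge0.
transitivity (\int[distribution W (mulmx Phi)]_f (a f * H f)).
  by apply: eq_integral => f _; rewrite (integral_mvnormal_iso s0 f mb b0).
transitivity (\int[W]_th (a (Phi *m th) * H (Phi *m th))).
  exact: (ge0_integral_pushforward mPhi).
have maHP : measurable_fun setT (fun th => a (Phi *m th) * H (Phi *m th)).
  exact: measurableT_comp maH mPhi.
have aHP0 th : 0 <= a (Phi *m th) * H (Phi *m th) by exact: aH0.
have [_ _ Wd] := Ww.
rewrite (@integral_density _ _ R lam W w _ mw w0 Wd maHP aHP0).
pose G (p : 'cV[R]_k * 'cV[R]_n) := b p.2 * ((resid_pdf p.2)%:E *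
   (a (Phi *m p.1) * post_pdf p.2 p.1)).
have mG : measurable_fun setT G.
  apply: emeasurable_funM; first exact: measurableT_comp mb measurable_snd.
  apply: emeasurable_funM.
    apply/measurable_EFinP.
    exact: measurableT_comp (measurable_resid_pdf U T s) measurable_snd.
  apply: emeasurable_funM.
    exact: measurableT_comp (measurableT_comp ma mPhi) measurable_fst.
  apply: (measurableT_comp measurable_post_pdf (g := fun p => (p.2, p.1))).
  by apply: measurable_fun_pair; [exact: measurable_snd|exact: measurable_fst].
have G0 p : 0 <= G p.
  rewrite mule_ge0// mule_ge0//; first by rewrite lee_fin ltW// resid_pdf_gt0.
  by rewrite mule_ge0// post_pdf_ge0.
transitivity (\int[lam]_th \int[lam]_y G (th, y)).
  apply: eq_integral => th _.
  rewrite muleAC /H -ge0_integralZl//.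
  - apply: eq_integral => y _; rewrite /G /post_pdf /= (iso_pdf_factor s0 UU uT).
    rewrite (EFinM (resid_pdf y)) (EFinM (w th)) muleCA [X in _ * X]muleCA.
    by rewrite !muleA.
  - exact: measurableT_comp mbi (pair1_measurable _).
  - by rewrite mule_ge0// lee_fin.
rewrite (fubini_tonelli G mG G0); apply: eq_integral => y _.
rewrite /G /=.
have map th : 0 <= a (Phi *m th) * post_pdf y th by rewrite mule_ge0// post_pdf_ge0.
have mmap : measurable_fun setT (fun th => a (Phi *m th) * post_pdf y th).
  apply: emeasurable_funM; first exact: measurableT_comp ma mPhi.
  exact: measurable_post_pdf2.
rewrite ge0_integralZl//.
- by rewrite ge0_integralZl// lee_fin ltW// resid_pdf_gt0.
- by apply: emeasurable_funM => //; exact: measurable_cst.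
- by move=> th _; rewrite mule_ge0// lee_fin ltW// resid_pdf_gt0.
Qed.

End bayes.

(** The likelihood is bounded in theta and [w] has integral 1. *)
Lemma post_pdf_lty y : \int[lam]_th post_pdf y th < +oo.
Proof.
have [_ _ Wd] := Ww.
pose c := (`|\det T| * s^-1 ^+ k * normal_peak 1 ^+ k)%R.
have c0 : (0 <= c)%R.
  by rewrite (le_trans _ (@ls_pdf_ub _ _ _ U _ _ s0 uT y 0%R))// ltW// ls_pdf_gt0.
apply: (@le_lt_trans _ _ (\int[lam]_th (c%:E * (w th)%:E))).
  apply: ge0_le_integral_nonmeasurable => th; first exact: post_pdf_ge0.
  by rewrite -EFinM lee_fin mulrC ler_wpM2r// ls_pdf_ub.
rewrite ge0_integralZl_EFin//.
- by rewrite -Wd// probability_setT mule1 ltry.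
- by move=> th _; rewrite lee_fin.
- exact/measurable_EFinP.
Qed.

Variable K : R.-pker 'cV[R]_n ~> 'cV[R]_n.
Hypothesis HK : is_posterior (distribution W (mulmx Phi)) s K.

Let ind (A : set 'cV[R]_n) (v : 'cV[R]_n) : \bar R := (\1_A v)%:E.
Let mind A : measurable A -> measurable_fun setT (ind A).
Proof. by move=> mA; apply/measurable_EFinP; exact: measurable_indic. Qed.
Let ind0 A v : 0 <= ind A v. Proof. by rewrite lee_fin. Qed.

Let int_ind (m : {measure set 'cV[R]_n -> \bar R}) A (f : 'cV[R]_n -> \bar R) :
  \int[m]_(x in A) f x = \int[m]_x (ind A x * f x).
Proof. by rewrite integral_mkcond epatch_indic; apply: eq_integral => x _; rewrite muleC. Qed.

Let restr_post_ge0 A y th : 0 <= ind A (Phi *m th) * post_pdf y th.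
Proof. by rewrite mule_ge0// post_pdf_ge0. Qed.

Let measurable_restr_post A : measurable A ->
  measurable_fun setT
    (fun p : 'cV[R]_n * 'cV[R]_k => ind A (Phi *m p.2) * post_pdf p.1 p.2).
Proof.
move=> mA; apply: emeasurable_funM; last exact: measurable_post_pdf.
exact: measurableT_comp (measurableT_comp (mind mA) mPhi) measurable_snd.
Qed.

Let post_mass A y := \int[lam]_th (ind A (Phi *m th) * post_pdf y th).

Let post_mass_ge0 A y : 0 <= post_mass A y.
Proof. by apply: integral_ge0 => th _; exact: restr_post_ge0. Qed.

Let measurable_post_mass A : measurable A -> measurable_fun setT (post_mass A).
Proof.
move=> mA.
apply: (measurable_fun_fubini_tonelli_F (m2 := lam) _ (measurable_restr_post mA)).
by move=> p; exact: restr_post_ge0.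
Qed.

Let post_massT y : post_mass setT y = \int[lam]_th post_pdf y th.
Proof. by apply: eq_integral => th _; rewrite /ind indicT mul1e. Qed.

Let resid0 y : 0 <= (resid_pdf y)%:E. Proof. by rewrite lee_fin ltW// resid_pdf_gt0. Qed.

Let mresid : measurable_fun setT (fun y => (resid_pdf y)%:E).
Proof. by apply/measurable_EFinP; exact: measurable_resid_pdf. Qed.

(* Both sides, multiplied by [resid_pdf], have the same integral over every
   measurable set: this is [is_posterior]. *)
Let K_ae A : measurable A ->
  \forall y \ae lam, K y A * post_mass setT y = post_mass A y.
Proof.
move=> mA; have mK : measurable_fun setT (K ^~ A) by exact: measurable_kernel.
pose h1 y := (resid_pdf y)%:E * post_mass A y.
pose h2 y := (resid_pdf y)%:E * (K y A * post_mass setT y).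
have mh1 : measurable_fun setT h1.
  by apply: emeasurable_funM => //; exact: measurable_post_mass.
have mh2 : measurable_fun setT h2.
  apply: emeasurable_funM => //; apply: emeasurable_funM => //.
  exact: measurable_post_mass.
have h10 y : 0 <= h1 y by rewrite mule_ge0.
(* The integral of [h1] is the prior probability of [A], hence at most 1; integrability is what
   allows passing from equal integrals to equality almost everywhere. *)
have h1oo : lam.-integrable setT h1.
  apply/integrableP; split => //.
  under eq_integral => y _ do rewrite gee0_abs//.
  have -> : \int[lam]_y h1 y = \int[lam]_y (cst 1 y * h1 y).
    by apply: eq_integral => y _; rewrite mul1e.
  rewrite -(@bayes_integral (ind A) (cst 1))//; last exact: mind.
  apply: (@le_lt_trans _ _ (\int[distribution W (mulmx Phi)]_f cst 1 f)).
    apply: ge0_le_integral_nonmeasurable => f.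
      by rewrite mule_ge0// integral_ge0.
    rewrite integral_cst// mul1e [X in _ * X]probability_setT mule1.
    by rewrite lee_fin indicE; case: (_ \in _).
  by rewrite integral_cst// mul1e [X in X < _]probability_setT ltry.
have h12 E : E `<=` setT -> measurable E ->
    \int[lam]_(y in E) h1 y = \int[lam]_(y in E) h2 y.
  move=> _ mE; rewrite (int_ind lam E h1) (int_ind lam E h2).
  have mb : measurable_fun setT (fun y => ind E y * K y A).
    by apply: emeasurable_funM => //; exact: mind.
  have b0 y : 0 <= ind E y * K y A by rewrite mule_ge0.
  have lhs : \int[lam]_y (ind E y * h1 y) = \int[distribution W (mulmx Phi)]_f
      (ind A f * \int[mvnormal f (s ^+ 2)%:M]_y ind E y).
    exact: esym (bayes_integral (mind mA) (ind0 A) (mind mE) (ind0 E)).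
  (* The right-hand side of [is_posterior]: no restriction on F, and the kernel carried by the
     function of y. *)
  have rhs : \int[lam]_y (ind E y * K y A * ((resid_pdf y)%:E * post_mass setT y)) =
      \int[distribution W (mulmx Phi)]_f
        (ind setT f * \int[mvnormal f (s ^+ 2)%:M]_y (ind E y * K y A)).
    exact: esym (bayes_integral (mind measurableT) (ind0 setT) mb b0).
  transitivity (\int[lam]_y (ind E y * K y A * ((resid_pdf y)%:E * post_mass setT y))).
    rewrite lhs rhs.
    have := HK mA mE; rewrite (int_ind _ A) => HKE.
    transitivity (\int[distribution W (mulmx Phi)]_f (ind A f * mvnormal f (s ^+ 2)%:M E)).
      by apply: eq_integral => f _; rewrite integral_indic ?setIT.
    rewrite HKE; apply: eq_integral => f _.
    by rewrite {1}/ind indicT mul1e (int_ind _ E).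
  by apply: eq_integral => y _; rewrite /h2 -muleA; congr (_ * _); rewrite muleCA.
have := integral_ae_eq measurableT h1oo mh2 h12.
apply: filterS => y /(_ I); rewrite /h1 /h2 => /esym.
have := resid_pdf_gt0 U s0 uT y => r0.
move=> /(congr1 (fun x => (resid_pdf y)^-1%:E * x)).
by rewrite !muleA -!EFinM mulVf ?gt_eqF// !mul1e.
Qed.

(** The null set of [K_ae] depends on [A]. The countably many boxes share one, and off it two finite
    measures that agree on boxes agree everywhere. *)
Lemma posterior_ae : \forall y \ae lam, forall A, measurable A ->
  K y A * \int[lam]_th post_pdf y th =
  \int[lam]_(th in mulmx Phi @^-1` A) post_pdf y th.
Proof.
have : \forall y \ae lam, forall m : nat,
    if unpickle m is Some r then
      K y (box r) * post_mass setT y = post_mass (box r) y else True.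
  apply: ae_foralln => m; case: unpickle => [r|]; last exact: aeW.
  by apply: K_ae; rewrite measurable_cVE; apply: sub_sigma_algebra; exists r.
apply: filterS => y hy A mA.
have post_oo := post_pdf_lty y; rewrite -post_massT in post_oo *.
have massfin : post_mass setT y \is a fin_num by rewrite ge0_fin_numE.
have mass0 : (0 <= fine (post_mass setT y))%R by rewrite fine_ge0.
(* Scaling [K y] by the total mass, instead of dividing by it, avoids a separate case for mass 0. *)
pose m1 : {measure set 'cV[R]_n -> \bar R} := mscale (NngNum mass0) (K y).
pose m2 := image_measure (mdensity lam (measurable_post_pdf2 y) (post_pdf_ge0 y)) mPhi.
have m1E B : m1 B = K y B * post_mass setT y.
  by rewrite -[LHS]/((fine (post_mass setT y))%:E * K y B) fineK// muleC.
have m2E B : measurable B -> m2 B = post_mass B y.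
  move=> mB; rewrite -[LHS]/(\int[lam]_(th in mulmx Phi @^-1` B) post_pdf y th).
  rewrite integral_mkcond epatch_indic; apply: eq_integral => th _.
  by rewrite muleC.
rewrite -m1E -[RHS]/(m2 A); apply: measure_cV_unique mA.
  by rewrite m1E prob_kernel mul1e.
move=> r; rewrite m1E m2E; last first.
  by rewrite measurable_cVE; apply: sub_sigma_algebra; exists r.
by have := hy (pickle r); rewrite pickleK.
Qed.

End posterior.

(** * Bounds in fixed dimension *)

Lemma tv_dist_le1 d (X : measurableType d) (R : realType)
    (P Q : {measure set X -> \bar R}) : P setT = 1%E -> Q setT = 1%E ->
  (tv_dist P Q <= 1)%E.
Proof.
move=> PT QT; apply: ge_ereal_sup => _ [A mA <-].
have bnd (m : {measure set X -> \bar R}) : m setT = 1%E ->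
    exists2 r, m A = r%:E & 0 <= r <= 1.
  move=> mT; have mA1 : (m A <= 1)%E by rewrite -mT le_measure ?inE.
  have mAf : m A \is a fin_num.
    by rewrite ge0_fin_numE// (le_lt_trans mA1)// ltry.
  by exists (fine (m A)); rewrite ?fineK// fine_ge0//= -lee_fin fineK.
have [u -> /andP[u0 u1]] := bnd _ PT; have [v -> /andP[v0 v1]] := bnd _ QT.
rewrite -EFinB/= lee_fin ler_norml; apply/andP; split; lra.
Qed.

Section fixed_dimension.
Context {R : realType}.
Variables (n k : nat) (U : 'M[R]_(n, k)) (T : 'M[R]_k) (s M : R).
Hypotheses (s0 : 0 < s) (UU : U^T *m U = 1%:M) (uT : T \in unitmx).
Variables (W : probability 'cV[R]_k R) (w : 'cV[R]_k -> R).
Hypothesis Ww : has_density W w.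
Variable K : R.-pker 'cV[R]_n ~> 'cV[R]_n.
Hypothesis HK : is_posterior (distribution W (mulmx (U *m T))) s K.
Variables (F0 : 'cV[R]_n) (th0 : 'cV[R]_k) (a b : R).
Hypothesis th0E : T *m th0 = U^T *m F0.
Hypotheses (a0 : 0 < a) (ab : a <= b).
Hypothesis wB : forall th, sqnorm (T *m (th - th0)) <= s ^+ 2 * M -> a <= w th <= b.
(** [p] is the bound of [std_normal_tail] at threshold M / 4, and [eta] that of [ls_pdf_le] at the
    same threshold. *)
Let p := Num.sqrt 2 ^+ k * expR (- (M / 4) / 4).
Hypothesis p1 : p < 1.
Let eta := `|\det T| * s^-1 ^+ k * normal_peak 1 ^+ k * expR (- (M / 4) / 2).

Local Notation lam := (@lebesgue_cV R _).
Local Notation ls_pdf := (ls_pdf U T s).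
Local Notation target y := (mvnormal (U *m U^T *m y) (s ^+ 2 *: (U *m U^T))).
Local Notation tail := [set z : 'cV[R]_k | M / 4 < sqnorm z].

Let mtail : measurable tail.
Proof.
rewrite -[X in measurable X]setTI (_ : [set z | _] = @sqnorm R k @^-1` `]M / 4, +oo[).
  exact: measurable_sqnorm.
by apply/seteqP; split => z /=; rewrite in_itv/= andbT.
Qed.

Let Ptail : (std_normal tail <= p%:E)%E. Proof. exact: std_normal_tail. Qed.

Let measurable_pre d d' (X : measurableType d) (Y : measurableType d') (f : X -> Y) A :
  measurable_fun setT f -> measurable A -> measurable (f @^-1` A).
Proof. by move=> mf mA; rewrite -[X in measurable X]setTI; exact: mf. Qed.

(* The exceptional event |U^T (y - F0)|^2 > s^2 M / 4. *)
Let far : set 'cV[R]_n := (fun y => s^-1 *: (U^T *m (y - F0))) @^-1` tail.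

Let mfar : measurable far.
Proof.
apply: measurable_pre => //.
by apply: measurable_cVZ; apply: measurable_cVM; exact: measurable_cVB.
Qed.

(** U^T maps a standard normal vector of R^n to one of R^k. Only U^T (y - F0) is involved, so the
    position of [F0] relative to the column space does not matter. *)
Let Pfar : (mvnormal F0 (s ^+ 2)%:M far <= p%:E)%E.
Proof.
apply: le_trans Ptail; rewrite le_eqVlt; apply/orP; left; apply/eqP.
rewrite -[far]setIT -(integral_indic _ measurableT mfar).
rewrite (@integral_mvnormal _ _ _ (1%:M : 'M[R]_n) _ s)//; last 3 first.
- by rewrite trmx1 mulmx1.
- by rewrite trmx1 mulmx1 scalemx1.
- by apply/measurable_EFinP; exact: measurable_indic.
transitivity (\int[std_normal]_v (\1_tail (U^T *m v : 'cV[R]_k))%:E)%E.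
  apply: eq_integral => v _; congr EFin; rewrite !indicE; congr (nat_of_bool _)%:R.
  apply: asbool_equiv_eq; rewrite /far/= addrC addKr mul1mx -scalemxAr.
  by rewrite scalerA mulVf ?gt_eqF// scale1r.
rewrite (@integral_std_normal_coisometry _ _ _ U^T (fun v => (\1_tail v)%:E)%E) ?trmxK//.
  by rewrite integral_indic// setIT.
by apply/measurable_EFinP; exact: measurable_indic.
Qed.

(** [Q y] is the target in the coordinate theta; [nu y] is the unnormalised posterior there. *)
Let Q y := mdensity lam (f := EFin \o ls_pdf y)
  ((measurable_EFinP _ _).2 (measurable_ls_pdf2 U T s y))
  (fun th => ltW (ls_pdf_gt0 U s0 uT y th)).

Let nu y := mdensity lam (measurable_post_pdf2 U T s Ww y) (post_pdf_ge0 U s0 uT Ww y).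

Let QE y A : measurable A -> target y A = Q y (mulmx (U *m T) @^-1` A).
Proof.
move=> mA; rewrite -[A in LHS]setIT -(integral_indic _ measurableT mA).
rewrite (integral_mvnormal_hat s0 UU uT)//; last first.
  by apply/measurable_EFinP; exact: measurable_indic.
rewrite -[RHS]/(\int[lam]_(th in mulmx (U *m T) @^-1` A) (ls_pdf y th)%:E)%E.
rewrite [RHS]integral_mkcond epatch_indic.
by apply: eq_integral => th _; rewrite muleC.
Qed.

Let QT y : Q y setT = 1%E.
Proof.
rewrite -[setT](preimage_setT (mulmx (U *m T))) -QE//.
exact: probability_setT.
Qed.

Let B := [set th : 'cV[R]_k | sqnorm (T *m (th - th0)) <= s ^+ 2 * M].

Let mB : measurable B.
Proof.
rewrite (_ : B = (fun th => sqnorm (T *m (th - th0)) : measurableTypeR R) @^-1` `]-oo, s ^+ 2 * M]).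
  rewrite -[X in measurable X]setTI.
  apply: measurableT_comp (@measurable_sqnorm R k) _ _ _ _ => //.
  by apply: measurable_cVM; exact: measurable_cVB.
by apply/seteqP; split => th /=; rewrite in_itv.
Qed.

(** T (theta - theta0) is the sum of T theta - U^T y and U^T (y - F0). By [sqnormD_le], these cannot
    both have squared norm at most s^2 M / 4 when that of their sum exceeds s^2 M. *)
Let far_residual y th : ~ far y -> ~ B th ->
  M / 4 * s ^+ 2 < sqnorm (T *m th - U^T *m y).
Proof.
move=> /negP; rewrite /far/= -leNgt sqnormZ exprVn ler_pdivrMl ?exprn_gt0// => near.
move=> /negP; rewrite /B/= -ltNge => Bth.
have E : T *m (th - th0) = (T *m th - U^T *m y) + U^T *m (y - F0).
  by rewrite !mulmxBr th0E addrA subrK.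
have := sqnormD_le (T *m th - U^T *m y) (U^T *m (y - F0)); rewrite -E.
move: near Bth; lra.
Qed.

(** Under the target, [pr] is standard normal on R^k, and by [far_residual] the complement of [B] is
    sent into its tail. *)
Let QB y : ~ far y -> (Q y (~` B) <= p%:E)%E.
Proof.
move=> ny; apply: le_trans Ptail.
pose pr (v : 'cV[R]_n) : 'cV[R]_k := s^-1 *: (U^T *m (v - y)).
have mpr : measurable_fun setT pr.
  by apply: measurable_cVZ; apply: measurable_cVM; exact: measurable_cVB.
have mptail : measurable (pr @^-1` tail) by exact: measurable_pre.
have pK : target y (pr @^-1` tail) = std_normal tail.
  rewrite -[pr @^-1` tail]setIT -(integral_indic _ measurableT mptail).
  rewrite (@integral_mvnormal _ _ _ U _ s)//; last first.
    by apply/measurable_EFinP; exact: measurable_indic.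
  rewrite -[tail in RHS]setIT -(integral_indic _ measurableT mtail).
  apply: eq_integral => v _; congr EFin; rewrite !indicE; congr (nat_of_bool _)%:R.
  apply: asbool_equiv_eq; rewrite /pr/= mulmxBr mulmxDr -scalemxAr.
  rewrite !(mulmxA U^T) UU !mul1mx addrAC subrr add0r.
  by rewrite scalerA mulVf ?gt_eqF// scale1r.
rewrite -pK QE//; apply: le_measure; rewrite ?inE.
- exact: measurableC.
- by apply: measurable_pre => //; exact: measurable_mulmx.
move=> th /(far_residual ny) h; rewrite /pr/= sqnormZ mulmxBr mulmxA (mulmxA U^T) UU mul1mx.
by rewrite exprVn ltr_pdivlMl ?exprn_gt0// mulrC.
Qed.

Let nuE y A : nu y A = (\int[lam]_(th in A) post_pdf U T s w y th)%E.
Proof. by []. Qed.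

Let mw : measurable_fun setT w. Proof. by case: Ww. Qed.
Let w0 x : 0 <= w x. Proof. by case: Ww. Qed.
Let mEls y : measurable_fun setT (EFin \o ls_pdf y).
Proof. by apply/measurable_EFinP; exact: measurable_ls_pdf2. Qed.
Let ls0 y th : 0 <= ls_pdf y th. Proof. by rewrite ltW// ls_pdf_gt0. Qed.
Let eta0 : 0 <= eta.
Proof. by rewrite !mulr_ge0 ?expR_ge0 ?exprn_ge0 ?invr_ge0 ?normal_peak_ge0// ltW. Qed.

(** Off [B] the values of [w] are not controlled, only its integral, which is at most 1; the
    smallness comes from the uniform bound [eta] on q_y. *)
Let nuB y : ~ far y -> (nu y (~` B) <= eta%:E)%E.
Proof.
move=> ny; rewrite nuE; have mBC : measurable (~` B) by exact: measurableC.
apply: (@le_trans _ _ (\int[lam]_(th in ~` B) (eta%:E * (w th)%:E)))%E.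
  apply: ge0_le_integral => //.
  - by move=> th _; exact: (post_pdf_ge0 U s0 uT Ww).
  - by apply: measurable_funTS; exact: (measurable_post_pdf2 U T s Ww).
  - by apply/measurable_EFinP; apply: measurable_funTS; exact: measurable_funM.
  - move=> th /(far_residual ny) h; rewrite -EFinM lee_fin mulrC ler_wpM2r//.
    by apply: ls_pdf_le => //; exact: ltW.
have [_ _ Wd] := Ww.
rewrite ge0_integralZl_EFin//; last 2 first.
- by move=> th _; rewrite lee_fin.
- by apply/measurable_EFinP; exact: measurable_funTS.
by rewrite -[leRHS]mule1 -Wd// lee_wpmul2l// ?lee_fin// probability_le1.
Qed.

Let le_nu y S : measurable S -> S `<=` B -> (a%:E * Q y S <= nu y S)%E.
Proof.
move=> mS SB.
rewrite nuE -[Q y S]/(\int[lam]_(th in S) (ls_pdf y th)%:E)%E.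
rewrite -ge0_integralZl_EFin//; last 3 first.
- by move=> th _; rewrite lee_fin.
- by apply: measurable_funTS; exact: mEls.
- exact: ltW.
apply: ge0_le_integral => //.
- by move=> th _; rewrite mule_ge0 ?lee_fin// ltW.
- by apply: emeasurable_funM => //; apply: measurable_funTS; exact: mEls.
- by apply: measurable_funTS; exact: (measurable_post_pdf2 U T s Ww).
by move=> th /SB/wB/andP[? _]; rewrite -EFinM lee_fin ler_wpM2r.
Qed.

Let ge_nu y S : measurable S -> S `<=` B -> (nu y S <= b%:E * Q y S)%E.
Proof.
move=> mS SB.
rewrite nuE -[Q y S]/(\int[lam]_(th in S) (ls_pdf y th)%:E)%E.
rewrite -ge0_integralZl_EFin//; last 3 first.
- by move=> th _; rewrite lee_fin.
- by apply: measurable_funTS; exact: mEls.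
- by rewrite (le_trans _ ab)// ltW.
apply: ge0_le_integral => //.
- by move=> th _; exact: (post_pdf_ge0 U s0 uT Ww).
- by apply: measurable_funTS; exact: (measurable_post_pdf2 U T s Ww).
- by apply: emeasurable_funM => //; apply: measurable_funTS; exact: mEls.
by move=> th /SB/wB/andP[_ ?]; rewrite -EFinM lee_fin ler_wpM2r.
Qed.

Let c := (b + eta) / (a * (1 - p)) - 1.

Let p0 : 0 <= p. Proof. by rewrite mulr_ge0 ?expR_ge0 ?exprn_ge0. Qed.

Let c0 : 0 <= c.
Proof.
rewrite subr_ge0 ler_pdivlMr ?mulr_gt0 ?subr_gt0// mul1r.
apply: (@le_trans _ _ a); first by rewrite ler_piMr ?(ltW a0)// lerBlDr lerDl.
by rewrite (le_trans ab)// lerDl.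
Qed.

(** The distance is at most [c] off [far] and [N], and at most 1 on them. The exceptional set [N] is
    Lebesgue-null, hence null for the true law of [y], which has the density [iso_pdf]. *)
Lemma expected_tv_le :
  (\int[mvnormal F0 (s ^+ 2)%:M]_y tv_dist (K y) (target y) <= (c + p)%:E)%E.
Proof.
have [N [mN N0 badN]] := posterior_ae s0 UU uT Ww HK.
pose bound y := (c%:E + (\1_far y)%:E + (\1_N y)%:E)%E.
have tv_bound_y y : (tv_dist (K y) (target y) <= bound y)%E.
  have KT : K y setT = 1%E by exact: prob_kernel.
  have targetT : target y setT = 1%E by exact: probability_setT.
  have i0 A : (0 <= (\1_A y : R)%:E)%E by rewrite lee_fin.
  have [yfar|nfar] := pselect (far y).
    apply: (le_trans (tv_dist_le1 KT targetT)); rewrite /bound indicE mem_set//.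
    by rewrite -addeA (le_trans (leeDl _ (i0 N)))// leeDr// lee_fin.
  have [yN|nN] := pselect (N y).
    apply: (le_trans (tv_dist_le1 KT targetT)); rewrite /bound [X in (_ + X%:E)%E]indicE mem_set//.
    by rewrite leeDr// adde_ge0 ?lee_fin.
  apply: (@le_trans _ _ c%:E); last by rewrite /bound -addeA leeDl// adde_ge0.
  apply: ge_ereal_sup => _ [A mA <-].
  have goody := contra_notP (badN y) nN.
  have KA : K y A \is a fin_num.
    rewrite ge0_fin_numE//; apply: (@le_lt_trans _ _ 1%E); last exact: ltry.
    by rewrite -KT le_measure ?inE.
  rewrite QE// -[in X in (X <= _)%E](fineK KA).
  apply: (@tv_bound _ _ R (Q y) (nu y) B a b p eta) => //.
  - by rewrite nuE; exact: (post_pdf_lty U s0 uT Ww y).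
  - exact: QB.
  - exact: nuB.
  - exact: le_nu.
  - exact: ge_nu.
  - by apply: measurable_pre => //; exact: measurable_mulmx.
  - by rewrite fine_ge0//= -lee_fin fineK// -KT le_measure ?inE.
  - by rewrite fineK// nuE goody// nuE.
apply: (@le_trans _ _ (\int[mvnormal F0 (s ^+ 2)%:M]_y bound y)%E).
  apply: ge0_le_integral_nonmeasurable => // y.
  by apply: ereal_sup_ubound; exists set0 => //; rewrite !measure0 sube0 abse0.
have mI (A : set 'cV[R]_n) : measurable A -> measurable_fun setT (fun y => (\1_A y : R)%:E).
  by move=> mA; apply/measurable_EFinP; exact: measurable_indic.
have i0 (A : set 'cV[R]_n) y : setT y -> (0 <= (\1_A y : R)%:E)%E by rewrite lee_fin.
have cst0 (y : 'cV[R]_n) : setT y -> (0 <= (cst c%:E) y)%E by rewrite lee_fin.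
have mcst : measurable_fun setT (cst c%:E : 'cV[R]_n -> \bar R) by exact: measurable_cst.
have cI0 y : setT y -> (0 <= cst c%:E y + (\1_far y)%:E)%E.
  by move=> _; rewrite adde_ge0 ?i0 ?cst0.
have mcI := emeasurable_funD mcst (mI _ mfar).
rewrite /bound (ge0_integralD _ measurableT cI0 mcI (i0 N) (mI N mN)).
rewrite (ge0_integralD _ measurableT cst0 mcst (i0 far) (mI far mfar)).
rewrite integral_cst// [X in (_ * X)%E]probability_setT mule1.
rewrite [X in (_ + X)%E](_ : _ = 0%E) ?adde0.
  by rewrite integral_indic// setIT [leRHS]EFinD leeD2l.
rewrite (integral_mvnormal_iso s0)//; last exact: mI.
rewrite -[RHS](@null_set_integral _ _ _ lam N (fun y => (iso_pdf s F0 y)%:E) mN _ N0).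
  rewrite integral_mkcond epatch_indic; apply: eq_integral => y _.
  by rewrite muleC.
apply: measurable_funTS; apply/measurable_EFinP.
apply: (measurableT_comp (f := fun q : _ * _ => iso_pdf s q.1 q.2) (g := pair F0)).
  exact: measurable_iso_pdf.
exact: pair1_measurable.
Qed.

End fixed_dimension.

(** * Explicit constants and passage to the limit *)

Lemma normal_peak1_le1 (R : realType) : normal_peak 1 <= 1 :> R.
Proof.
have h : 1 <= Num.sqrt (1 ^+ 2 * pi *+ 2) :> R.
  rewrite -[leLHS]sqrtr1 ler_sqrt expr1n mul1r mulr2n; have := pi_ge2 R; lra.
by rewrite /normal_peak invf_le1// (lt_le_trans ltr01).
Qed.

(** A positive supremum provides a point of the ellipsoid where [w] is positive; a zero of [w]
    elsewhere in it would then give the quotient +oo. Comparing a point with the centre, in both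
    orders, yields the two bounds. *)
Lemma sup_ratio_bounds (R : realType) n p (Phi : 'M[R]_(n, p)) (w : 'cV[R]_p -> R)
    (t0 : 'cV[R]_p) (r e : R) :
  (forall x, 0 <= w x) -> 0 <= r -> 0 < e ->
  (0 < sup_ratio Phi w t0 r)%E -> (sup_ratio Phi w t0 r <= (1 + e)%:E)%E ->
  0 < w t0 /\
  forall th, enorm (Phi *m (th - t0)) ^+ 2 <= r ->
    w t0 / (1 + e) <= w th <= (1 + e) * w t0.
Proof.
move=> w0 r0 e0 S0 S1.
have ball0 : enorm (Phi *m (0 : 'cV_p)) ^+ 2 <= r.
  by rewrite mulmx0 sqr_enorm (eqP (_ : sqnorm 0 == 0)) ?sqnorm_eq0.
have ratio h g : enorm (Phi *m h) ^+ 2 <= r -> enorm (Phi *m g) ^+ 2 <= r ->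
    ((w (t0 + h))%:E / (w (t0 + g))%:E <= (1 + e)%:E)%E.
  by move=> hr gr; apply: le_trans S1; apply: ereal_sup_ubound; exists (h, g).
have pos h g : enorm (Phi *m h) ^+ 2 <= r -> enorm (Phi *m g) ^+ 2 <= r ->
    0 < w (t0 + h) -> 0 < w (t0 + g) /\ w (t0 + h) <= (1 + e) * w (t0 + g).
  move=> hr gr wh; have := ratio _ _ hr gr; rewrite inver.
  have [wg0|wg] := eqVneq (w (t0 + g)) 0.
    by rewrite gt0_muley ?lte_fin// leye_eq.
  have wg0 : 0 < w (t0 + g) by rewrite lt_def wg w0.
  by rewrite -EFinM lee_fin ler_pdivrMr.
have [h hr wh] : exists2 h, enorm (Phi *m h) ^+ 2 <= r & 0 < w (t0 + h).
  apply: contrapT => noh; move: S0; apply/negP; rewrite -leNgt.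
  apply: ge_ereal_sup => _ [[h g] [/= hr gr] <-].
  rewrite (_ : w (t0 + h) = 0) ?mul0e//; apply/eqP; rewrite eq_le w0 andbT leNgt.
  by apply/negP => wh; apply: noh; exists h.
have [wt0 _] := pos _ _ hr ball0 wh; rewrite addr0 in wt0.
split=> // th thr; rewrite -(subrK t0 th) [_ - _ + _]addrC.
have [wth le1] := pos 0 (th - t0) ball0 thr (eq_ind_r (fun x => 0 < w x) wt0 (addr0 t0)).
have [_ le2] := pos (th - t0) 0 thr ball0 wth.
rewrite addr0 in le1 le2; rewrite le2 andbT ler_pdivrMr; last lra.
by rewrite mulrC.
Qed.

(** A single tolerance [e] governs the oscillation of [w] on the ellipsoid, the Gaussian tail, and
    the ratio of [eta] to the lower bound of [w]. *)
Lemma expected_tv_small (R : realType) n k (Phi : 'M[R]_(n, k)) (s M e : R)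
    (W : probability 'cV[R]_k R) (w : 'cV[R]_k -> R) (K : R.-pker 'cV[R]_n ~> 'cV[R]_n)
    (F0 : 'cV[R]_n) :
  0 < s -> \rank Phi = k -> has_density W w ->
  is_posterior (distribution W (mulmx Phi)) s K ->
  0 < e <= 2^-1 -> 0 < w (ls_coef Phi F0) ->
  (forall th, enorm (Phi *m (th - ls_coef Phi F0)) ^+ 2 <= s ^+ 2 * M ->
    w (ls_coef Phi F0) / (1 + e) <= w th <= (1 + e) * w (ls_coef Phi F0)) ->
  Num.sqrt 2 ^+ k * expR (- (M / 4) / 4) <= e ->
  Num.sqrt (\det (Phi^T *m Phi)) / (s ^+ k * w (ls_coef Phi F0)) *
    expR (- (M / 4) / 2) <= e / 2 ->
  (\int[mvnormal F0 (s ^+ 2)%:M]_y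
     tv_dist (K y) (mvnormal (hat_mx Phi *m y) (s ^+ 2 *: hat_mx Phi)) <= (10 * e)%:E)%E.
Proof.
move=> s0 rPhi Ww HK /andP[e0 e2] wt0 wB p_small eta_small.
have [U [T [UU uT PhiE hatE [lsE detE]]]] := exists_QR rPhi.
rewrite hatE; rewrite -{}detE in eta_small.
set t0 := ls_coef Phi F0 in wt0 wB eta_small.
have t0E : T *m t0 = U^T *m F0 by rewrite /t0 lsE mulKVmx.
move: HK wB; rewrite {}PhiE => HK wB.
clearbody t0; clear lsE hatE rPhi Phi.
have w1e : 0 < 1 + e by lra.
have a0 : 0 < w t0 / (1 + e) by rewrite divr_gt0.
have ab : w t0 / (1 + e) <= (1 + e) * w t0.
  by rewrite ler_pdivrMr//; nra.
have p1 : Num.sqrt 2 ^+ k * expR (- (M / 4) / 4) < 1 by lra.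
have wB' th : sqnorm (T *m (th - t0)) <= s ^+ 2 * M ->
    w t0 / (1 + e) <= w th <= (1 + e) * w t0.
  move=> h; apply: wB; rewrite sqr_enorm -mulmxA sqnorm_mulmx//.
apply: le_trans (expected_tv_le s0 UU uT Ww HK t0E a0 ab wB' p1) _.
rewrite lee_fin; set p := Num.sqrt 2 ^+ k * _ in p_small p1 *.
set eta := _ * expR (- (M / 4) / 2).
(* The spare factor 1/2 in [eta_small] pays for replacing [w t0] by [w t0 / (1 + e)], as 1 + e <=
   2. *)
have eta_le : eta <= e * (w t0 / (1 + e)).
  apply: (@le_trans _ _ (e / 2 * w t0)); last first.
    rewrite -!mulrA ler_pM2l// [leRHS]mulrC ler_pM2r// lef_pV2 ?posrE//; lra.
  rewrite -ler_pdivrMr//; apply: le_trans eta_small.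
  rewrite /eta invfM -exprVn !mulrA mulrAC ler_pM2r ?expR_gt0//.
  rewrite ler_pM2r ?invr_gt0// ler_piMr ?mulr_ge0 ?exprn_ge0 ?invr_ge0 ?(ltW s0)//.
  (* The normalising factor (2 pi)^(-k/2), absent from hypothesis (3), is at most 1. *)
  by rewrite exprn_ile1 ?normal_peak_ge0 ?normal_peak1_le1.
have p0 : 0 <= p by rewrite mulr_ge0 ?expR_ge0 ?exprn_ge0.
set a := w t0 / (1 + e) in a0 eta_le *.
have -> : (1 + e) * w t0 = (1 + e) ^+ 2 * a by rewrite /a; field; rewrite gt_eqF.
clearbody a eta p.
suff : ((1 + e) ^+ 2 * a + eta) / (a * (1 - p)) <= 1 + 10 * e - p by lra.
rewrite ler_pdivrMr ?mulr_gt0 ?subr_gt0//.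
(* The inequality (1 + e)^2 + e <= (1 + 9 e) (1 - e) amounts to 5 e (1 - 2 e) >= 0, whence the
   condition e <= 1/2; the tenth [e] is for [p]. *)
apply: (@le_trans _ _ ((1 + 9 * e) * (a * (1 - e)))); last first.
  apply: ler_pM; [lra|rewrite mulr_ge0 ?(ltW a0)//; lra|lra|].
  by rewrite ler_pM2l//; lra.
apply: (@le_trans _ _ (((1 + e) ^+ 2 + e) * a)).
  by rewrite mulrDl lerD2l.
by rewrite [a * _]mulrC mulrA ler_pM2r//; nra.
Qed.

Theorem theorem2 (R : realType)
  (sigma : nat -> R) (F0 : forall n, 'cV[R]_n)
  (k : nat -> nat) (Phi : forall n, 'M[R]_(n, k n))
  (Wt : forall n, probability 'cV[R]_(k n) R)
  (w : forall n, 'cV[R]_(k n) -> R)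
  (post : forall n, R.-pker 'cV[R]_n ~> 'cV[R]_n)
  (M : nat -> R)
  (sigma_gt0 : forall n, (0 < n)%N -> 0 < sigma n)
  (k_bounds : forall n, (0 < n)%N -> (1 <= k n <= n)%N)
  (k_grows : \forall n \near \oo, (2 <= k n)%N)
  (Phi_rank : forall n, (0 < n)%N -> \rank (Phi n) = k n)
  (W_density : forall n, (0 < n)%N -> has_density (Wt n) (w n))
  (post_spec : forall n, (0 < n)%N ->
     is_posterior (distribution (Wt n) (mulmx (Phi n))) (sigma n) (post n))
  (M_gt0 : forall n, (0 < n)%N -> 0 < M n)
  (H1 : sup_ratio (Phi n) (w n) (ls_coef (Phi n) (F0 n)) (sigma n ^+ 2 * M n)
          @[n --> \oo] --> 1%E)
  (H2 : (fun n => (k n)%:R * ln (k n)%:R : R^o) =o_\oo (M : nat -> R^o))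
  (H3 : (fun n => Num.max 0
           (ln (Num.sqrt (\det ((Phi n)^T *m Phi n)) /
                (sigma n ^+ k n * w n (ls_coef (Phi n) (F0 n))))) : R^o)
        =o_\oo (M : nat -> R^o)) :
  (\int[mvnormal (F0 n) (sigma n ^+ 2)%:M]_y
     tv_dist (post n y)
       (mvnormal (hat_mx (Phi n) *m y) (sigma n ^+ 2 *: hat_mx (Phi n))))%E
    @[n --> \oo] --> 0%E.

Proof.
set I := fun n => (\int[_]_y _)%E.
have I0 n : (0 <= I n)%E.
  apply: integral_ge0 => y _; apply: ereal_sup_ubound; exists set0 => //.
  by rewrite !measure0 sube0 abse0.
have ln2 : 0 < ln (2 : R) by rewrite ln_gt0// ltr1n.
have small (e : R) : 0 < e <= 2^-1 -> \forall n \near \oo, (I n <= (10 * e)%:E)%E.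
  move=> /andP[e0 e2].
  have /fine_cvgP[H1f /cvgrPdist_lt/(_ e e0) H1e] := H1.
  (* The two rates serve the two uses of (2): 1/32 gives 2^k <= exp (M / 32), half of the exponent M
     / 16 of the tail bound, and e ln 2 / 64 gives e M >= 64. *)
  have tau0 : 0 < Num.min 32^-1 (e * ln 2 / 64).
    by rewrite lt_min invr_gt0 ltr0n/= divr_gt0// mulr_gt0.
  have /eqoP/(_ _ tau0) H2e := H2.
  have c32 : 0 < 32^-1 :> R by rewrite invr_gt0.
  have /eqoP/(_ _ c32) H3e := H3.
  near=> n.
  have n0 : (0 < n)%N by near: n; exact: nbhs_infty_gt.
  have k2 : (2 <= k n)%N by near: n.
  have Sfin : sup_ratio (Phi n) (w n) (ls_coef (Phi n) (F0 n)) (sigma n ^+ 2 * M n)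
      \is a fin_num by near: n.
  have S1 : `|1 - fine (sup_ratio (Phi n) (w n) (ls_coef (Phi n) (F0 n))
      (sigma n ^+ 2 * M n))| < e by near: n.
  have kM : `|(k n)%:R * ln (k n)%:R : R^o| <=
      Num.min 32^-1 (e * ln 2 / 64) * `|M n : R^o| by near: n.
  have DM : `|Num.max 0 (ln (Num.sqrt (\det ((Phi n)^T *m Phi n)) /
      (sigma n ^+ k n * w n (ls_coef (Phi n) (F0 n))))) : R^o| <=
      32^-1 * `|M n : R^o| by near: n.
  have Mn0 := M_gt0 n n0; have sn0 := sigma_gt0 n n0.
  rewrite (gtr0_norm Mn0) in kM DM.
  have kk : ln 2 <= ln ((k n)%:R : R) by rewrite ler_ln ?posrE ?ltr0n ?ler_nat// (leq_trans _ k2).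
  have kR : 2 <= (k n)%:R :> R by rewrite ler_nat.
  have {}kM : (k n)%:R * ln (k n)%:R <= Num.min 32^-1 (e * ln 2 / 64) * M n.
    exact: le_trans (ler_norm _) kM.
  have kM1 : (k n)%:R * ln (k n)%:R <= M n / 32.
    apply: le_trans kM _; rewrite mulrC ler_pM2l// ge_min lexx//.
  have kM2 : (k n)%:R * ln (k n)%:R <= e * ln 2 / 64 * M n.
    by apply: le_trans kM _; rewrite ler_pM2r// ge_min lexx orbT.
  (* Here k >= 2 is essential: it gives k ln k >= ln 2, so that (2) bounds [M n] from below. *)
  have eM : 64 <= e * M n.
    have : ln 2 <= e * ln 2 / 64 * M n by apply: le_trans kM2; nra.
    rewrite (_ : e * ln 2 / 64 * M n = ln 2 * (e * M n / 64)); last by field.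
    by rewrite -[leLHS]mulr1 ler_pM2l//; lra.
  (* From exp (M / 32) >= 1 + M / 32 and M / 32 >= 2 / e. *)
  have expM : expR (- (M n / 32)) <= e / 2.
    rewrite expRN -[leRHS]invrK lef_pV2 ?posrE ?invr_gt0 ?expR_gt0 ?divr_gt0//.
    apply: le_trans (expR_ge1Dx _); rewrite invf_div ler_pdivrMr//; nra.
  have Wd := W_density n n0; have [mw w0 _] := Wd.
  have [||||wt0 wB] := @sup_ratio_bounds R n (k n) (Phi n) (w n)
    (ls_coef (Phi n) (F0 n)) (sigma n ^+ 2 * M n) e w0 => //.
  - by rewrite mulr_ge0 ?exprn_ge0// ltW.
  - by move: S1; rewrite -(fineK Sfin) lte_fin ltr_norml => /andP[_]; lra.
  - by move: S1; rewrite -(fineK Sfin) lee_fin ltr_norml => /andP[+ _]; lra.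
  apply: (expected_tv_small sn0 (Phi_rank n n0) Wd (post_spec n n0) _ wt0 wB).
  - by rewrite e0.
  - apply: (@le_trans _ _ (expR (M n / 32) * expR (- (M n / 4) / 4))).
      rewrite ler_pM2r ?expR_gt0//; apply: (@le_trans _ _ (2 ^+ k n)).
        have sqrt2 : Num.sqrt 2 <= 2 :> R.
          by rewrite -[leRHS]ger0_norm// -sqrtr_sqr ler_sqrt expr2; lra.
        by rewrite lerXn2r ?nnegrE ?sqrtr_ge0.
      rewrite -[2 in leLHS](@lnK R) ?posrE// -expRM_natl ler_expR.
      by apply: le_trans kM1; rewrite ler_pM2l// ltr0n (leq_trans _ k2).
    rewrite -expRD (_ : _ + _ = - (M n / 32)); last by field.
    by apply: le_trans expM _; lra.
  (* [lnK] requires D > 0; otherwise the product to be bounded is nonpositive. In the main case D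
     exp (- M / 8) <= exp (M / 32 - M / 8), well below exp (- M / 32). *)
  - set D := _ / _ in DM *; have [D0|D0] := leP D 0.
      apply: (@le_trans _ _ 0); last by rewrite divr_ge0// ltW.
      by rewrite mulr_le0_ge0// expR_ge0.
    have lnD : ln D <= M n / 32.
      rewrite [leRHS]mulrC; apply: le_trans DM; apply: le_trans (ler_norm _).
      by rewrite le_max lexx orbT.
    rewrite -(@lnK R D) ?posrE// -expRD; apply: le_trans expM; rewrite ler_expR.
    lra.
apply/fine_cvgP; split.
  near=> n; rewrite ge0_fin_numE//; apply: (@le_lt_trans _ _ (10 * 2^-1)%:E); last exact: ltry.
  by near: n; apply: small; rewrite invr_gt0 ltr0n lexx.
apply/cvgrPdist_le => eps eps0.
pose e := Num.min 2^-1 (eps / 10).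
have e0 : 0 < e <= 2^-1 by rewrite ge_min lexx lt_min invr_gt0 ltr0n divr_gt0.
near=> n; have In : (I n <= (10 * e)%:E)%E by near: n; exact: small.
have Ifin : I n \is a fin_num by rewrite ge0_fin_numE// (le_lt_trans In)// ltry.
rewrite sub0r normrN/= ger0_norm ?fine_ge0// -lee_fin fineK//.
apply: (le_trans In); rewrite lee_fin mulrC -ler_pdivlMr//.
by rewrite /e ge_min lexx orbT.
Unshelve. all: by end_near. Qed.
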